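(* There is an absolute constant $c>0$ such that the following holds. Let $F$ be a field of odd positive characteristic $p$, and let $A\subset F_*=F\setminus\{0\}$ be a finite set with $|A|>1$ and $|A|<p^{8/13}$. Then $$|1/A+1/(A+A)|\ \ge\ c\,|A|^{9/8}.$$
   Context: $1/A=\{a^{-1}: a\in A\}$ and $1/(A+A)=\{(a+b)^{-1}: a,b\in A,\ a+b\ne0\}$. Thus $1/A+1/(A+A)=\{\frac1c+\frac1{a+b}: a,b,c\in A,\ a+b\neq0\}$. *)

(* Defs.v *)
From mathcomp Require Import all_boot all_order all_algebra finmap.
From mathcomp Require Import reals exp.

Set Implicit Arguments.
Unset Strict Implicit.
Unset Printing Implicit Defensive.

Import Order.TTheory GRing.Theory Num.Theory.

Local Open Scope fset_scope.
Local Open Scope ring_scope.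

Definition sumset (F : fieldType) (A B : {fset F}) : {fset F} :=
  [fset a + b | a in A, b in B].

(* The restriction to nonzero elements discards the pairs with a + b = 0 in
   1/(A+A); in MathComp 0^-1 = 0, so they would otherwise contribute 0. *)
Definition recip (F : fieldType) (A : {fset F}) : {fset F} :=
  [fset a^-1 | a in A & a != 0].

Lemma in_sumset_recip (F : fieldType) (A : {fset F}) (x : F) :
  0 \notin A ->
  reflect (exists a b c : F,
             [/\ a \in A, b \in A, c \in A, a + b != 0 & x = c^-1 + (a + b)^-1])
          (x \in sumset (recip A) (recip (sumset A A))).
Proof.
move=> A0; apply: (iffP idP) => [/imfset2P|].
  move=> [_ /imfsetP[c /= /andP[cA _] ->]].
  move=> [_ /imfsetP[_ /= /andP[/imfset2P[a /= aA [b /= bA ->]] ab0] ->] ->].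
  by exists a, b, c.
move=> [a [b [c [aA bA cA ab0 ->]]]]; apply/imfset2P.
exists c^-1.
  apply/imfsetP; exists c => //=; rewrite inE cA /=.
  by apply: contraNneq A0 => <-.
exists (a + b)^-1 => //; apply/imfsetP; exists (a + b) => //=.
by rewrite inE ab0 andbT; apply/imfset2P; exists a => //; exists b.
Qed.

(* Main.v *)
(* Attach to c1 <> c2 in A the line l through the points (x, l(x)) =
   (c2 - c2^2/y, c1 - c1^2/y) with y = c1 + c2 + e, e in A; both coordinates are
   reciprocals of elements of S = 1/A + 1/(A+A).  So about |A|^2 lines have
   about |A| points each on the grid 1/S x 1/S, and by Cauchy-Schwarz there are
   at least about |A|^6/|S| coincidences l(x') = l'(x) between pairs (l, x) and
   (l', x').

   After a change of coordinates over F(t), a coincidence is an intersection of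
   a "row" line X = a Y + b, Z = z attached to (l, x) and a "column" line
   X = c Z + d, Y = y attached to (l', x').  Interpolate a polynomial of degree
   at most D in each variable, with 2D < p, that vanishes on many rows, hence on
   all columns meeting more than 8D of them.  By Bezout, some prime factor g
   contains many columns, and d^2X/dY^2 along g = 0 vanishes on the rows, hence
   on the columns, hence modulo g.  Since 2D < p this makes g = 0 ruled by lines
   in the (X, Y)-direction; its columns then lie on one bilinear surface, and
   such a surface contains at most |S| + 2|A| of them.  Comparing both bounds on
   the number of coincidences gives |A|^9 < 2^33 |S|^8. *)

Require Import Defs.
From mathcomp Require Import all_boot all_order all_algebra finmap.
From mathcomp Require Import reals exp.
From mathcomp Require Import boolp ring zify perm.

Set Implicit Arguments.
Unset Strict Implicit.
Unset Printing Implicit Defensive.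

Import Order.TTheory GRing.Theory Num.Theory.

Local Open Scope fset_scope.
Local Open Scope ring_scope.

(** * Unique factorization in polynomial rings *)

Definition divides (R : idomainType) (a b : R) : Prop := exists q, b = a * q.

Definition prime_elt (R : idomainType) (c : R) : Prop :=
  [/\ c != 0, c \isn't a GRing.unit
    & forall a b, divides c (a * b) -> divides c a \/ divides c b].

Definition prime_product (R : idomainType) (a : R) : Prop :=
  exists (u : R) (s : seq R),
    [/\ u \is a GRing.unit, {in s, forall c, prime_elt c}
      & a = u * \prod_(c <- s) c].

(** Uniqueness of the factorization is not asked for: it is automatic when the factors are prime and
    not merely irreducible. *)
Definition factorial_domain (R : idomainType) : Prop :=
  forall a : R, a != 0 -> prime_product a.

Section Divides.
Variable R : idomainType.
Implicit Types (a b c : R) (p q : {poly R}).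

Lemma dividesMr a b c : divides a b -> divides a (b * c).
Proof. by case=> q ->; exists (q * c); rewrite mulrA. Qed.

Lemma dividesMl a b c : divides a b -> divides a (c * b).
Proof. by rewrite mulrC; apply: dividesMr. Qed.

Lemma dividesD a b c : divides a b -> divides a c -> divides a (b + c).
Proof. by case=> q -> [r ->]; exists (q + r); rewrite mulrDr. Qed.

Lemma dividesN a b : divides a b -> divides a (- b).
Proof. by case=> q ->; exists (- q); rewrite mulrN. Qed.

Lemma divides_trans a b c : divides a b -> divides b c -> divides a c.
Proof. by case=> q -> [r ->]; exists (q * r); rewrite mulrA. Qed.

Lemma divides_sum (I : Type) (r : seq I) (P : pred I) (F : I -> R) a :
  (forall i, P i -> divides a (F i)) -> divides a (\sum_(i <- r | P i) F i).
Proof.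
move=> aF; elim/big_rec: _ => [|i x Pi]; first by exists 0; rewrite mulr0.
exact/dividesD/aF.
Qed.

Lemma prime_divides_prod (s : seq R) c :
  prime_elt c -> divides c (\prod_(x <- s) x) -> exists2 x, x \in s & divides c x.
Proof.
move=> [c0 cu cP]; elim: s => [|x s IHs].
  rewrite big_nil => -[q q1]; case/negP: cu; apply/unitrPr; exists q.
  by rewrite -q1.
rewrite big_cons => /cP[cx|/IHs[y ys cy]]; first by exists x; rewrite ?mem_head.
by exists y; rewrite // inE ys orbT.
Qed.

Lemma divides_unit u a : u \is a GRing.unit -> divides a u -> a \is a GRing.unit.
Proof. by move=> uu [q uq]; move: uu; rewrite uq unitrM => /andP[]. Qed.

Lemma prime_divides_unitM u a c :
  u \is a GRing.unit -> prime_elt c -> divides c (u * a) -> divides c a.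
Proof.
by move=> uu [_ cu cP] /cP[] // /(divides_unit uu); rewrite (negPf cu).
Qed.

Lemma divides_polyC c p : divides c%:P p <-> forall i, divides c p`_i.
Proof.
split=> [[q ->] i|cp]; first by exists q`_i; rewrite coefCM.
have [q qP] := choice cp.
exists (\poly_(i < size p) q i); apply/polyP=> i; rewrite coefCM coef_poly.
by case: ltnP => [_|/(nth_default 0) ->]; rewrite ?mulr0 // -qP.
Qed.

(** Gauss's lemma. If [c] divides neither factor, take the first coefficients it fails to divide, at
    indices i and j; in coefficient i + j of the product every other term is divisible by [c]. *)
Lemma prime_polyC c : prime_elt c -> prime_elt c%:P.
Proof.
move=> [c0 cu cP]; split; first by rewrite polyC_eq0.
  by rewrite poly_unitE size_polyC c0 coefC /= (negPf cu).
have key p : ~ divides c%:P p -> exists i, ~ divides c p`_i /\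
    forall j, (j < i)%N -> divides c p`_j.
  move=> /divides_polyC /existsNP[i ci].
  elim/ltn_ind: i ci => i IHi ci.
  case: (EM (forall j, (j < i)%N -> divides c p`_j)) => [h|]; first by exists i.
  by move=> /existsNP[j] /not_implyP[/IHi h /h].
move=> p q cpq.
case: (EM (divides c%:P p)) => [|/key[i [ci ltci]]]; [by left|].
case: (EM (divides c%:P q)) => [|/key[j [cj ltcj]]]; [by right|].
suff /cP[] : divides c (p`_i * q`_j) by [].
move/divides_polyC: cpq => /(_ (i + j)%N); rewrite coefM.
have ij : (i < (i + j).+1)%N by rewrite ltnS leq_addr.
rewrite (bigD1 (Ordinal ij)) //= addKn => h.
rewrite -[_ * _](addrK (\sum_(k < (i + j).+1 | k != Ordinal ij) p`_k * q`_(i + j - k))).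
apply: dividesD h _; apply/dividesN/divides_sum => k.
rewrite -val_eqE /= neq_ltn => /orP[/ltci|ki]; first exact: dividesMr.
apply/dividesMl/ltcj; rewrite ltn_subLR ?ltn_add2r //.
by rewrite -ltnS.
Qed.

End Divides.

Section PolyFactorial.
Variable R : idomainType.
Hypothesis facR : factorial_domain R.
Implicit Types (a b c : R) (p q : {poly R}).

(** Primitivity of [p], expressed without gcds of coefficients. *)
Definition no_const_prime p := forall c, prime_elt c -> ~ divides c%:P p.

Lemma cancel_const c p g m : c != 0 -> no_const_prime p ->
  c%:P * g = p * m -> divides p g.
Proof.
move=> /facR[u [s [uu sP ->]]] pP.
elim: s sP g m => [|x s IHs] sP g m.
  rewrite big_nil mulr1 => ug; exists (u^-1%:P * m).
  by rewrite mulrCA -ug mulrA -polyCM mulVr // mul1r.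
rewrite big_cons => eqgm.
have xP := sP _ (mem_head _ _).
have [_ _ xP'] := prime_polyC xP.
have : divides x%:P (p * m).
  rewrite -eqgm mulrCA polyCM -mulrA; apply: dividesMr; by exists 1; rewrite mulr1.
case/xP' => [/pP //|[m' m'E]].
apply: (IHs _ g m'); first by move=> y ys; apply: sP; rewrite inE ys orbT.
apply: (@mulfI _ x%:P); first by rewrite polyC_eq0; case: xP.
by rewrite [RHS]mulrCA -m'E -eqgm [LHS]mulrA -polyCM mulrCA.
Qed.

(** The primes of [c] are shared out between [d] and [q] one at a time. This turns a factorization
    over the fraction field into one over [R] without introducing fractions. *)
Lemma split_const c p d q : c != 0 -> c%:P * p = d * q ->
  exists d' q', p = d' * q' /\ exists c1, c1 != 0 /\ d = c1%:P * d'
   /\ exists c2, c2 != 0 /\ q = c2%:P * q'.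
Proof.
move=> /facR[u [s [uu sP ->]]].
have u0 : u != 0 by apply: contraTneq uu => ->; rewrite unitr0.
elim: s sP d q => [|x s IHs] sP d q.
  rewrite big_nil mulr1 => up; exists (u^-1%:P * d), q; split.
    by rewrite -mulrA -up mulrA -polyCM mulVr // mul1r.
  exists u; split => //; split; first by rewrite mulrA -polyCM divrr // mul1r.
  by exists 1; rewrite oner_eq0 mul1r.
rewrite big_cons => eqdq.
have xP := sP _ (mem_head _ _).
have x0 : x != 0 by case: xP.
have [_ _ xP'] := prime_polyC xP.
have sP' : {in s, forall c, prime_elt c}.
  by move=> y ys; apply: sP; rewrite inE ys orbT.
have : divides x%:P (d * q).
  rewrite -eqdq mulrCA polyCM -mulrA; apply: dividesMr; by exists 1; rewrite mulr1.
have xI : injective ( *%R x%:P) by apply: mulfI; rewrite polyC_eq0.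
case/xP' => -[m mE].
  have /(IHs sP')[d' [q' [-> [c1 [c10 [mE' [c2 [c20 ->]]]]]]]] :
      (u * \prod_(j <- s) j)%:P * p = m * q.
    by apply: xI; rewrite mulrA -polyCM mulrCA eqdq mE mulrA.
  exists d', q'; split => //; exists (x * c1); rewrite mulf_neq0 //; split => //.
  by rewrite mE mE' mulrA polyCM; split => //; exists c2.
have /(IHs sP')[d' [q' [-> [c1 [c10 [-> [c2 [c20 mE']]]]]]]] :
    (u * \prod_(j <- s) j)%:P * p = d * m.
  by apply: xI; rewrite mulrA -polyCM mulrCA eqdq mE mulrCA.
exists d', q'; split => //; exists c1; split => //; split => //.
by exists (x * c2); rewrite mulf_neq0 // mE mE' mulrA polyCM.
Qed.

(** A nonzero element [d] of least size in the ideal (p, g) divides every element of it up to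
    constants. By irreducibility either [d] is constant, and multiplying its expression by [h] shows
    that [p] divides [h], or [d] is [p] up to constants, and [p] divides [g]. *)
Lemma irreducible_prime p : (1 < size p)%N -> no_const_prime p ->
  (forall d q : {poly R}, p = d * q -> (size d <= 1)%N \/ (size q <= 1)%N) -> prime_elt p.
Proof.
move=> p1 pP pirr.
have p0 : p != 0 by rewrite -size_poly_gt0 ltnW.
split=> //; first by rewrite poly_unitE gtn_eqF.
move=> g h [m ghE].
pose Q n := `[<exists a b : {poly R}, a * p + b * g != 0 /\ size (a * p + b * g)%R = n>].
have exQ : exists n, Q n.
  by exists (size p); apply/asboolP; exists 1, 0; rewrite mul1r mul0r addr0.
case: (ex_minnP exQ) => n /asboolP[a [b [d0 dn]]] nmin.
set d := a * p + b * g in d0 dn.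
have red (f : {poly R}) : (exists a' b' : {poly R}, f = a' * p + b' * g) ->
    exists c (q : {poly R}), c != 0 /\ c%:P * f = d * q.
  move=> [a' [b' fE]].
  have := Pdiv.Idomain.divp_eq f d.
  set k := scalp f d; set q := Pdiv.Idomain.divp f d => E.
  exists (lead_coef d ^+ k), q; split; first by rewrite expf_neq0 // lead_coef_eq0.
  rewrite mul_polyC E [q * d]mulrC; set r := Pdiv.Idomain.modp f d in E *.
  suff -> : r = 0 by rewrite addr0.
  (* A nonzero pseudo-remainder would be a smaller element of the ideal. *)
  apply/eqP/negP => /negP r0.
  have : (size r < size d)%N by rewrite Pdiv.Idomain.ltn_modp.
  rewrite ltnNge dn => /negP; apply; apply: nmin; apply/asboolP.
  exists ((lead_coef d ^+ k)%:P * a' - q * a), ((lead_coef d ^+ k)%:P * b' - q * b).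
  suff <- : r = ((lead_coef d ^+ k)%:P * a' - q * a) * p +
      ((lead_coef d ^+ k)%:P * b' - q * b) * g by [].
  have -> : r = (lead_coef d ^+ k)%:P * f - q * d.
    by rewrite mul_polyC E addrAC subrr add0r.
  rewrite fE /d !mulrDr !mulrDl !mulNr !opprD !mulrA.
  by rewrite addrACA.
have [c [q [c0 cpE]]] : exists c (q : {poly R}), c != 0 /\ c%:P * p = d * q.
  by apply: red; exists 1, 0; rewrite mul1r mul0r addr0.
have [d' [q' [pE [c1 [c10 [dE [c2 [c20 qE]]]]]]]] := split_const c0 cpE.
have sdE : size d = size d' by rewrite dE size_Cmul.
have d'0 : d' != 0 by rewrite -size_poly_gt0 -sdE size_poly_gt0.
have q'0 : q' != 0 by apply: contra_neq p0 => q'0; rewrite pE q'0 mulr0.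
case: (pirr _ _ pE) => [d1|q1].
- right.
  have /size1_polyC dC : (size d <= 1)%N by rewrite sdE.
  have e0 : d`_0 != 0 by apply: contra_neq d0 => e0; rewrite dC e0.
  apply: (@cancel_const _ _ _ (a * h + b * m) e0 pP).
  rewrite -dC /d mulrDl mulrDr -!mulrA ghE; congr (_ + _); first by rewrite mulrCA.
  by rewrite mulrCA.
- left.
  have q'C := size1_polyC q1; set e := q'`_0 in q'C.
  have e0 : e != 0 by apply: contra_neq q'0 => e0; rewrite q'C e0.
  (* A prime factor of the constant [e] would divide [p]. *)
  have eu : e \is a GRing.unit.
    have [u [[|x s] [uu sP eE]]] := facR e0; first by rewrite eE big_nil mulr1.
    case: (pP x); first by apply: sP; rewrite mem_head.
    rewrite pE q'C; apply: dividesMl; apply/divides_polyC => -[|i]; rewrite coefC /=.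
      rewrite eE big_cons mulrCA; apply: dividesMr; by exists 1; rewrite mulr1.
    by exists 0; rewrite mulr0.
  have [c' [r [c'0 gE]]] : exists c' (r : {poly R}), c' != 0 /\ c'%:P * g = d * r.
    by apply: red; exists 0, 1; rewrite mul1r mul0r add0r.
  apply: (@cancel_const c' _ _ (e^-1%:P * c1%:P * r) c'0 pP).
  have ee : e%:P * e^-1%:P = 1 :> {poly R} by rewrite -polyCM divrr.
  by rewrite gE dE pE q'C -[LHS]mul1r -ee; ring.
Qed.

(** Split into nonconstant factors as long as possible. What remains is irreducible up to constants,
    and its constant primes are removed one by one; each uses up a prime of the leading coefficient,
    which bounds their number. *)
Lemma factorial_poly : factorial_domain {poly R}.
Proof.
move=> p; have [n] := ubnP (size p); elim: n => // n IHn in p *.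
rewrite ltnS => pn p0.
have cat_fac (d q : {poly R}) :
    p = d * q -> prime_product d -> prime_product q -> prime_product p.
  move=> -> [u [s [uu sP ->]]] [v [t [vv tP ->]]]; exists (u * v), (s ++ t).
  split; first by rewrite unitrM uu vv.
    by move=> x; rewrite mem_cat => /orP[/sP|/tP].
  by rewrite big_cat /= mulrACA.
have const_fac c : c != 0 -> prime_product c%:P.
  move=> /facR[u [s [uu sP ->]]]; exists u%:P, (map polyC s); split.
  - have u0 : u != 0 by apply: contraTneq uu => ->; rewrite unitr0.
    by rewrite poly_unitE size_polyC u0 coefC.
  - by move=> _ /mapP[x /sP xP ->]; apply: prime_polyC.
  - by rewrite big_map polyCM rmorph_prod.
have [/size1_polyC pC|p1] := leqP (size p) 1.
  by rewrite pC; apply: const_fac; rewrite -polyC_eq0 -pC.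
case: (EM (exists d q : {poly R}, p = d * q /\ (1 < size d)%N /\ (1 < size q)%N)).
  move=> [d [q [pE [d1 q1]]]].
  have d0 : d != 0 by rewrite -size_poly_gt0 ltnW.
  have q0 : q != 0 by rewrite -size_poly_gt0 ltnW.
  have szp : size p = (size d + size q).-1 by rewrite pE size_mul.
  apply: (cat_fac _ _ pE); apply: IHn => //; rewrite (leq_trans _ pn) // szp -subn1;
    rewrite ltn_subRL; [rewrite addnC|]; by rewrite (ltn_add2r, ltn_add2l).
move=> pirr'.
have {cat_fac const_fac pirr'} pirr (d q : {poly R}) :
    p = d * q -> (size d <= 1)%N \/ (size q <= 1)%N.
  move=> pE; have [|d1] := leqP (size d) 1; [by left|right].
  by rewrite leqNgt; apply/negP => q1; apply: pirr'; exists d, q.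
have [u [s [uu sP lE]]] : prime_product (lead_coef p) by apply: facR; rewrite lead_coef_eq0.
have [m] := ubnP (size s).
elim: m p p0 {pn} p1 pirr u s uu sP lE => // m IHm p p0 p1 pirr u s uu sP lE; rewrite ltnS => sm.
case: (EM (exists2 c, c \in s & divides c%:P p)) => [[c cs [p' pE]]|nc].
  have c0 : c != 0 by case: (sP _ cs).
  have p'0 : p' != 0 by apply: contra_neq p0 => p'0; rewrite pE p'0 mulr0.
  have [v [t [vv tP p'E]]] : prime_product p'.
    apply: (IHm p' p'0 _ _ u (rem c s)) => //.
    - by rewrite pE size_Cmul in p1.
    - move=> d q p'E; have : p = (c%:P * d) * q by rewrite pE p'E mulrA.
      by case/pirr; [rewrite size_Cmul //; left|right].
    - by move=> x /mem_rem; apply: sP.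
    - by apply: (mulfI c0); rewrite -[c in LHS]lead_coefC -lead_coefM -pE lE
         (big_rem c cs) /= mulrCA.
    - by rewrite size_rem // (leq_trans _ sm) // prednK // -has_predT; apply/hasP; exists c.
  exists v, (c%:P :: t); split => //.
    by move=> x; rewrite inE => /orP[/eqP ->|/tP //]; apply/prime_polyC/sP.
  by rewrite big_cons mulrCA -p'E.
exists 1, [:: p]; split; rewrite ?unitr1 ?big_seq1 ?mul1r //.
move=> x; rewrite inE => /eqP ->.
apply: irreducible_prime => // c cP cp; apply: nc.
(* A constant prime [c] dividing [p] divides some prime [y] of the leading coefficient; the two are
   then associates, so [y] divides [p] as well. *)
move/divides_polyC: (cp) => /(_ (size p).-1); rewrite -lead_coefE lE.
move=> /(prime_divides_unitM uu cP) /(prime_divides_prod cP)[y ys cy].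
exists y => //; case: cy => e yE.
have [y0 yu yP] := sP _ ys.
have : divides y (c * e) by exists 1; rewrite mulr1 -yE.
case/yP => [[c' cE]|[e' eE]].
  by apply: divides_trans cp; exists c'%:P; rewrite cE polyCM.
case: cP => _ /negP[]; apply/unitrPr; exists e'.
apply: (mulfI y0).
by rewrite mulr1 {2}yE eE mulrCA.
Qed.
End PolyFactorial.

Lemma factorial_field (F : fieldType) : factorial_domain F.
Proof.
by move=> a a0; exists a, [::]; split=> //; rewrite ?unitfE ?big_nil ?mulr1.
Qed.

(** * Bezout by resultants *)

Lemma card_roots_le (R : idomainType) (J : finType) (y : J -> R) (q : {poly R}) :
  injective y -> q != 0 -> (#|[pred j | q.[y j] == 0%R]| <= (size q).-1)%N.
Proof.
move=> yI q0; rewrite -ltnS prednK ?size_poly_gt0 // cardE -(size_map y).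
apply: max_poly_roots => //; last by rewrite map_inj_uniq ?enum_uniq.
by apply/allP=> _ /mapP[j jq ->]; rewrite mem_enum inE in jq.
Qed.

Lemma size_det_rows (R : comNzRingType) n (M : 'M[{poly R}]_n) (d : 'I_n -> nat) :
  (forall i j, (size (M i j) <= (d i).+1)%N) ->
  (size (\det M) <= (\sum_i d i).+1)%N.
Proof.
move=> Md; apply: leq_trans (size_sum _ _ _) _; apply/bigmax_leqP=> s _.
have szs : size ((-1) ^+ odd_perm s * \prod_i M i (s i))%R = size (\prod_i M i (s i))%R.
  by case: (odd_perm s); rewrite ?expr1 ?mulN1r ?size_polyN ?expr0 ?mul1r.
rewrite szs.
elim/big_ind2: _ => [|n1 p1 n2 p2 le1 le2|i _] //; first by rewrite size_poly1.
by apply: leq_trans (size_polyMleq _ _) _; lia.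
Qed.

(** The Sylvester matrix has [(size q).-1] rows of coefficients of [p] and [(size p).-1] rows of
    coefficients of [q]; the degrees of the rows add up. *)
Lemma size_resultant (R : comNzRingType) (p q : {poly {poly R}}) :
  (size (resultant p q) <= ((size q).-1 * (sizeY p).-1 +
                            (size p).-1 * (sizeY q).-1).+1)%N.
Proof.
pose d (i : 'I_((size q).-1 + (size p).-1)) :=
  match split i with inl _ => (sizeY p).-1 | inr _ => (sizeY q).-1 end.
have -> : ((size q).-1 * (sizeY p).-1 + (size p).-1 * (sizeY q).-1 = \sum_i d i)%N.
  rewrite big_split_ord /=; congr (_ + _)%N.
    under eq_bigr => i _ do rewrite /d -[lshift _ i]/(unsplit (inl i)) unsplitK.
    by rewrite sum_nat_const card_ord.
  under eq_bigr => i _ do rewrite /d -[rshift _ i]/(unsplit (inr i)) unsplitK.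
  by rewrite sum_nat_const card_ord.
apply: size_det_rows => i j; rewrite Sylvester_mxE /d.
by case: (split i) => k /=; case: (k <= j)%N; rewrite ?mulr1n ?mulr0n ?size_poly0 //;
  apply: leq_trans (max_size_coefXY _ _) (leqSpred _).
Qed.

(** If the resultant vanished, [g] and [h] would have a nonconstant common factor [d] up to
    constants, c g = q d. If [g] divides [q], then [d] divides a nonzero constant; if [g] divides
    [d], then it divides a constant multiple of [h], hence [h]. *)
Lemma prime_resultant_neq0 (R : idomainType) (g h : {poly R}) :
  (1 < size g)%N -> prime_elt g -> ~ divides g h -> resultant g h != 0.
Proof.
move=> g1 [g0 _ gP] gh; rewrite resultant_eq0 -leqNgt leqNgt; apply/negP.
set d := gcdp g h => d1.
have /Pdiv.Idomain.dvdpP[[c q] /= c0 cg] := Pdiv.Idomain.dvdp_gcdl g h.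
have /Pdiv.Idomain.dvdpP[[c' r] /= c'0 ch] := Pdiv.Idomain.dvdp_gcdr g h.
rewrite -/d -!mul_polyC in cg ch.
have gc (a : R) : a != 0 -> ~ divides g a%:P.
  move=> a0 [b ab]; have := size_polyC a; rewrite ab a0 /=.
  have b0 : b != 0 by apply: contra_neq a0 => b0; apply/eqP; rewrite -polyC_eq0 ab b0 mulr0.
  rewrite size_mul //; have := size_poly_gt0 b; rewrite b0; lia.
have : divides g (q * d) by exists c%:P; rewrite -cg mulrC.
case/gP=> [[q' qE]|[d' dE]].
  have cE : c%:P = q' * d.
    by apply: (mulfI g0); rewrite mulrC cg qE mulrA.
  have := size_polyC c; rewrite cE c0.
  have q'0 : q' != 0 by apply: contra_neq c0 => q'0; apply/eqP; rewrite -polyC_eq0 cE q'0 mul0r.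
  have d0 : d != 0 by rewrite -size_poly_gt0 ltnW.
  by rewrite size_mul //; have := size_poly_gt0 q'; rewrite q'0; lia.
have : divides g (c'%:P * h) by exists (r * d'); rewrite ch dE mulrCA.
by case/gP => // /gc; apply.
Qed.

Section Bezout.
Variables (R : idomainType) (J : finType) (x y : J -> R).
Hypothesis y_inj : injective y.

(** The resultant lies in the ideal of [g] and [h], so it vanishes at the [y]-coordinate of every
    common zero; these are distinct, so its degree bounds their number. *)
Lemma bezout_card (g h : {poly {poly R}}) :
  (1 < size g)%N -> prime_elt g -> ~ divides g h ->
  (#|[pred j | (g.[x j, y j] == 0%R) && (h.[x j, y j] == 0%R)]|
    <= (size h).-1 * (sizeY g).-1 + (size g).-1 * (sizeY h).-1)%N.
Proof.
move=> g1 gP gh.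
(* [resultant_in_ideal] wants both sizes above 1, so an [h] free of the outer variable is treated
   apart. *)
have [h1|h1] := leqP (size h) 1.
  have hC := size1_polyC h1; set c := h`_0 in hC.
  have c0 : c != 0.
    by apply: contra_notN gh => /eqP c0; exists 0; rewrite hC c0 mulr0.
  apply: leq_trans (_ : #|[pred j | c.[y j] == 0%R]| <= _)%N.
    apply: subset_leq_card; apply/subsetP => j; rewrite !inE => /andP[_].
    by rewrite hC hornerC.
  apply: leq_trans (card_roots_le y_inj c0) _.
  apply: leq_trans (leq_addl _ _); apply: (@leq_trans (sizeY h).-1).
    by rewrite -!subn1 leq_sub2r // max_size_coefXY.
  by rewrite leq_pmull // -subn1 subn_gt0.
have := card_roots_le y_inj (prime_resultant_neq0 g1 gP gh).
have := size_resultant g h; have [[u v] /= _ resE] := resultant_in_ideal g1 h1.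
move=> szr /(leq_trans _) le; apply: leq_trans (le _ _) _.
  apply: subset_leq_card; apply/subsetP => j; rewrite !inE => /andP[/eqP gj /eqP hj].
  have := congr1 (fun r => r.[x j, y j]) resE.
  by rewrite hornerC hornerD !hornerM hornerD !hornerM gj hj !mulr0 addr0 => /eqP.
by rewrite -ltnS prednK // size_poly_gt0; apply: prime_resultant_neq0.
Qed.

End Bezout.

(** * The flecnode polynomial *)

Section Substitution.
Variable R : comNzRingType.
Implicit Types (u v g : {poly {poly R}}) (U V : {poly R}).

(** In bivariate polynomials X is the outer and Y the inner variable; [deriv] differentiates in
    X. *)
Definition derivY u := map_poly (@deriv R) u.

Definition subst2 U V u : {poly R} := (map_poly (comp_poly V) u).[U].

Lemma subst2D U V u v : subst2 U V (u + v) = subst2 U V u + subst2 U V v.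
Proof. by rewrite /subst2 rmorphD hornerD. Qed.

Lemma subst2B U V u v : subst2 U V (u - v) = subst2 U V u - subst2 U V v.
Proof. by rewrite /subst2 rmorphB hornerD hornerN. Qed.

Lemma subst2M U V u v : subst2 U V (u * v) = subst2 U V u * subst2 U V v.
Proof. by rewrite /subst2 rmorphM hornerM. Qed.

Lemma subst2C U V (q : {poly R}) : subst2 U V q%:P = q \Po V.
Proof. by rewrite /subst2 map_polyC hornerC. Qed.

Lemma subst2X U V : subst2 U V 'X = U.
Proof. by rewrite /subst2 map_polyX hornerX. Qed.

Lemma derivY_deriv u : derivY u^`() = (derivY u)^`().
Proof.
by apply/polyP=> i; rewrite coef_map !coef_deriv coef_map /= derivMn.
Qed.

Lemma derivYD u v : derivY (u + v) = derivY u + derivY v.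
Proof. by rewrite /derivY raddfD. Qed.

Lemma derivYC (q : {poly R}) : derivY q%:P = q^`()%:P.
Proof. by rewrite /derivY map_polyC. Qed.

Lemma derivYMX u : derivY (u * 'X) = derivY u * 'X.
Proof.
apply/polyP=> i; rewrite coef_map !coefMX.
by case: i => [|i] /=; rewrite ?linear0 // coef_map.
Qed.

Lemma deriv_subst2 U V u :
  (subst2 U V u)^`() = subst2 U V u^`() * U^`() + subst2 U V (derivY u) * V^`().
Proof.
elim/poly_ind: u => [|u q IHu].
  by rewrite /derivY /subst2 !raddf0 !horner0 deriv0 !mul0r addr0.
rewrite subst2D subst2M subst2X subst2C !derivD derivM IHu derivM derivX mulr1.
rewrite derivC addr0 derivYD derivYMX derivYC deriv_comp.
by rewrite !subst2D !subst2M !subst2X !subst2C; ring.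
Qed.

(* The numerator of d^2X/dY^2 along the branches X = X(Y) of u = 0. *)
Definition flec u : {poly {poly R}} :=
  derivY (derivY u) * (u^`() * u^`()) - 2%:R * (derivY u^`() * u^`() * derivY u)
  + u^`()^`() * (derivY u * derivY u).

(** Restricted to a line, G' = b u_X + c u_Y, and G'' is the second-order analogue; eliminating u_Y
    leaves only terms with a factor G' or G''. So [flec u] vanishes on lines inside u = 0, and when
    [u] divides [flec u] the identity is a linear differential equation for G. *)
Lemma flec_line (a b c d : R) u :
  let U := a%:P + b%:P * 'X in let V := d%:P + c%:P * 'X in
  let G := subst2 U V u in let s := subst2 U V in
  c%:P ^+ 2 * s (flec u) = s u^`() ^+ 2 * G^`()^`()
    + G^`() * (s u^`()^`() * (G^`() - 2%:R * b%:P * s u^`())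
               - 2%:R * c%:P * s (derivY u^`()) * s u^`()).
Proof.
move=> U V G s.
have dU : U^`() = b%:P by rewrite derivD derivM !derivC derivX mul0r !add0r mulr1.
have dV : V^`() = c%:P by rewrite derivD derivM !derivC derivX mul0r !add0r mulr1.
have s2 v : s (2%:R * v) = 2%:R * s v.
  by rewrite !(mulr_natl _ 2) !mulr2n /s subst2D.
have -> : G^`()^`() = b%:P ^+ 2 * s u^`()^`() + 2%:R * b%:P * c%:P * s (derivY u^`())
    + c%:P ^+ 2 * s (derivY (derivY u)).
  rewrite /G deriv_subst2 dU dV derivD !derivM !derivC !mulr0 !addr0.
  by rewrite !deriv_subst2 dU dV -derivY_deriv /s; ring.
have -> : G^`() = b%:P * s u^`() + c%:P * s (derivY u).
  by rewrite /G deriv_subst2 dU dV /s; ring.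
rewrite /flec [in s (_ + _)]/s subst2D subst2B -/(s (2%:R * _)) s2 /s !subst2M.
by ring.
Qed.

Lemma size_subst2 U V u : (size U <= 2)%N -> (size V <= 2)%N ->
  (size (subst2 U V u) <= ((size u).-1 + (sizeY u).-1).+1)%N.
Proof.
move=> U2 V2; rewrite /subst2 horner_coef.
apply: leq_trans (size_sum _ _ _) _; apply/bigmax_leqP=> i _.
apply: leq_trans (size_polyMleq _ _) _.
have szU : (size (U ^+ i) <= i.+1)%N.
  elim: (i : nat) => [|k IHk]; first by rewrite expr0 size_poly1.
  by rewrite exprS; apply: leq_trans (size_polyMleq _ _) _; lia.
have szi : (i <= (size u).-1)%N.
  have := ltn_ord i; have : (size (map_poly (comp_poly V) u) <= size u)%N.
    exact: size_poly.
  lia.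
have szc : (size ((map_poly (comp_poly V) u)`_i)%R <= (sizeY u).-1.+1)%N.
  rewrite coef_map /=; apply: leq_trans (size_comp_poly_leq _ _) _.
  have V1 : ((size V).-1 <= 1)%N by case: (size V) V2.
  rewrite ltnS (leq_trans (leq_mul (leqnn _) V1)) // muln1 -!subn1 leq_sub2r //.
  exact: max_size_coefXY.
apply: leq_trans (_ : ((sizeY u).-1.+1 + i.+1).-1 <= _)%N.
  by rewrite -subn1 -[X in (_ <= X)%N]subn1 leq_sub2r // leq_add.
by rewrite addnS /= addSn ltnS addnC leq_add2r.
Qed.

End Substitution.

(** Uniqueness for a linear equation of second order. If all earlier coefficients of G vanish, the
    coefficient of degree k of the equation reduces to a_0 (k+2)(k+1) G_(k+2) = 0, and the
    hypothesis on characteristic allows division. *)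
Lemma ode_eq0 (R : idomainType) (G a M Q : {poly R}) :
  a * G^`()^`() + G^`() * M = G * Q -> a`_0 != 0 -> G`_0 = 0 -> G`_1 = 0 ->
  (forall k, (0 < k < size G)%N -> k%:R != 0 :> R) -> G = 0.
Proof.
move=> eqG a0 G0 G1 char; apply/polyP=> k; rewrite coef0.
elim/ltn_ind: k => -[|[|k]] IHk //.
have [szk|szk] := leqP (size G) k.+2; first by rewrite nth_default.
have := congr1 (fun q : {poly R} => q`_k) eqG.
rewrite coefD !coefM big_ord_recl /= [X in _ + X + _]big1 ?addr0; last first.
  move=> i _; rewrite !coef_deriv /bump /= IHk ?mul0rn ?mulr0 //.
  by have := ltn_ord i; lia.
rewrite [X in _ + X]big1 ?addr0; last first.
  move=> i _; rewrite coef_deriv IHk ?mul0rn ?mul0r //.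
  by have := ltn_ord i; lia.
rewrite [RHS]big1; last first.
  by move=> i _; rewrite IHk ?mul0r //; have := ltn_ord i; lia.
rewrite subn0 !coef_deriv => /eqP; rewrite mulf_eq0 (negPf a0) /=.
rewrite -mulrnA -[_ *+ _]mulr_natr mulf_eq0 natrM mulf_eq0.
by rewrite (negPf (char k.+2 szk)) (negPf (char k.+1 (ltnW szk))) !orbF => /eqP.
Qed.

(** Pseudo-division of [g] by the equation [l] of the line leaves a remainder in Y alone, which
    vanishes on the line and so is zero, as c != 0. Hence [g] divides Q l; it must divide [l], since
    otherwise [l] would divide a nonzero constant. *)
Lemma prime_line (R : idomainType) (g : {poly {poly R}}) (a b c d : R) :
  prime_elt g -> c != 0 -> subst2 (a%:P + b%:P * 'X) (d%:P + c%:P * 'X) g = 0 ->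
  forall x y, g.[x, y] = 0 -> c * (x - a) = b * (y - d).
Proof.
move=> [g0 gu gP] c0 sg x y gxy.
set U := a%:P + b%:P * 'X in sg; set V := d%:P + c%:P * 'X in sg.
pose q : {poly R} := (c * a)%:P + b%:P * ('X - d%:P).
pose l : {poly {poly R}} := c%:P%:P * 'X - q%:P.
have cc0 : c%:P != 0 :> {poly R} by rewrite polyC_eq0.
have szl : size l = 2.
  rewrite /l mul_polyC size_polyDl ?size_polyN.
    by rewrite size_scale // size_polyX.
  by rewrite size_scale // size_polyX ltnS size_polyC_leq1.
have sl : subst2 U V l = 0.
  rewrite /l subst2B subst2M !subst2C subst2X /q -polyCN.
  by rewrite !(comp_polyD, comp_polyM, comp_polyC, comp_polyX) /U /V polyCM polyCN; ring.
have l0 : l != 0 by rewrite -size_poly_eq0 szl.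
have := Pdiv.Idomain.divp_eq g l.
set k := scalp g l; set Q := Pdiv.Idomain.divp g l; set r := Pdiv.Idomain.modp g l.
have : (size r < size l)%N by rewrite Pdiv.Idomain.ltn_modp.
rewrite szl ltnS => /size1_polyC; set r0 := r`_0 => -> gE.
have r00 : r0 = 0.
  have := congr1 (subst2 U V) gE.
  rewrite -mul_polyC subst2M sg mulr0 subst2D subst2M sl mulr0 add0r subst2C => r0E.
  have V2 : size V = 2.
    by rewrite /V mul_polyC addrC size_polyDl ?size_scale ?size_polyX // ltnS size_polyC_leq1.
  by apply/eqP; rewrite -size_poly_eq0 -(size_comp_poly2 r0 V2) -r0E size_poly0.
rewrite r00 addr0 -mul_polyC in gE.
have lc0 : lead_coef l ^+ k != 0 by rewrite expf_neq0 // lead_coef_eq0.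
have : divides g (Q * l) by exists (lead_coef l ^+ k)%:P; rewrite -gE mulrC.
case/gP=> [[Q' QE]|[l' lE]].
  have lcE : (lead_coef l ^+ k)%:P = Q' * l.
    by apply: (mulfI g0); rewrite mulrC gE QE mulrA.
  have := size_polyC (lead_coef l ^+ k); rewrite lc0 lcE.
  have Q'0 : Q' != 0.
    apply: contra_neq lc0 => Q'0; apply/eqP.
    by rewrite -polyC_eq0 lcE Q'0 mul0r.
  by rewrite size_mul // szl; have := size_poly_gt0 Q'; rewrite Q'0; lia.
have := congr1 (fun p => p.[x, y]) lE; rewrite !hornerM gxy mul0r /l /q.
rewrite !hornerE => /eqP; rewrite subr_eq0 => /eqP h.
by rewrite mulrBr h; ring.
Qed.

(** * Degrees *)

Lemma kernel_exists (K : fieldType) (U C : finType) (M : U -> C -> K) :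
  (#|C| < #|U|)%N ->
  exists v : U -> K, (exists u, v u != 0) /\ forall c, \sum_u v u * M u c = 0.
Proof.
move=> ltCU; pose A := \matrix_(i < #|U|, j < #|C|) M (enum_val i) (enum_val j).
have : kermx A != 0.
  rewrite -mxrank_eq0 mxrank_ker -lt0n subn_gt0.
  exact: leq_ltn_trans (rank_leq_col A) ltCU.
case/rowV0Pn=> w /sub_kermxP wA w0; exists (fun u => w 0 (enum_rank u)); split.
  case/rV0Pn: w0 => i wi; exists (enum_val i); by rewrite enum_valK.
move=> c; have := congr1 (fun B : 'rV_ _ => B 0 (enum_rank c)) wA.
rewrite !mxE => {2}<-; rewrite (reindex (enum_val : 'I_#|U| -> U)) /=.
  by apply: eq_bigr => i _; rewrite enum_valK mxE enum_rankK.
by exists enum_rank => i _; rewrite ?enum_valK ?enum_rankK.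
Qed.

Section Degrees.
Variable K : nzRingType.
Implicit Types (q : {poly {poly K}}) (u v : {poly {poly {poly K}}}).

Lemma sizeY_le (R : nzRingType) (q : {poly {poly R}}) n :
  (sizeY q <= n)%N <-> forall i, (size (q`_i)%R <= n)%N.
Proof.
split=> [qn i|qn]; first exact: leq_trans (max_size_coefXY q i) qn.
by apply/bigmax_leqP=> i _.
Qed.

(** Three variables are nested as X, Y, Z from the outside in; swapping Y and Z in each coefficient
    lets [sizeY] see the degree in Z. *)
Definition sizeZ u : nat := sizeY (map_poly swapXY u).

Lemma sizeZ_le u n : (sizeZ u <= n)%N <-> forall i, (sizeY (u`_i)%R <= n)%N.
Proof.
by split=> [/sizeY_le un i|un]; [|apply/sizeY_le => i];
  [have := un i | have := un i]; rewrite coef_map /= -sizeYE.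
Qed.

Lemma sizeZ_le2 u n :
  (sizeZ u <= n)%N <-> forall i j, (size (u`_i`_j)%R <= n)%N.
Proof.
by split=> [/sizeZ_le un i|un]; [|apply/sizeZ_le => i]; apply/sizeY_le.
Qed.

Lemma sizeYD (R : nzRingType) (p q : {poly {poly R}}) n :
  (sizeY p <= n)%N -> (sizeY q <= n)%N -> (sizeY (p + q) <= n)%N.
Proof.
move=> pn qn; rewrite sizeYE rmorphD (leq_trans (size_polyD _ _)) //.
by rewrite geq_max -!sizeYE pn.
Qed.

Lemma sizeZD u v n : (sizeZ u <= n)%N -> (sizeZ v <= n)%N -> (sizeZ (u + v) <= n)%N.
Proof. by rewrite /sizeZ rmorphD; apply: sizeYD. Qed.

Lemma size_mulrn_le (R : nzRingType) (p : {poly R}) k : (size (p *+ k) <= size p)%N.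
Proof.
apply/leq_sizeP => j pj; rewrite coefMn.
by rewrite (nth_default 0 pj) mul0rn.
Qed.

Lemma size_deriv_le (R : nzRingType) (p : {poly R}) : (size p^`() <= size p)%N.
Proof.
by have [->|/lt_size_deriv/ltnW//] := eqVneq p 0; rewrite deriv0.
Qed.

Lemma sizeY_deriv_le (R : nzRingType) (p : {poly {poly R}}) : (sizeY p^`() <= sizeY p)%N.
Proof.
apply/sizeY_le => i; rewrite coef_deriv (leq_trans (size_mulrn_le _ _)) //.
exact: max_size_coefXY.
Qed.

Lemma sizeZ_deriv_le u : (sizeZ u^`() <= sizeZ u)%N.
Proof.
apply/sizeZ_le2 => i j; rewrite coef_deriv coefMn (leq_trans (size_mulrn_le _ _)) //.
by have /sizeZ_le2 := leqnn (sizeZ u); apply.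
Qed.

End Degrees.

Section DegreesCom.
Variable K : comNzRingType.
Implicit Types (u v : {poly {poly {poly K}}}).

Lemma size_derivY_le (R : comNzRingType) (p : {poly {poly R}}) :
  (size (derivY p) <= size p)%N.
Proof. exact: size_poly. Qed.

Lemma sizeY_derivY_le (R : comNzRingType) (p : {poly {poly R}}) :
  (sizeY (derivY p) <= sizeY p)%N.
Proof.
apply/sizeY_le => i; rewrite coef_map (leq_trans (size_deriv_le _)) //.
exact: max_size_coefXY.
Qed.

Lemma sizeZ_derivY_le u : (sizeZ (derivY u) <= sizeZ u)%N.
Proof.
apply/sizeZ_le2 => i j; rewrite coef_map coef_deriv (leq_trans (size_mulrn_le _ _)) //.
by have /sizeZ_le2 := leqnn (sizeZ u); apply.
Qed.

(** Each term of [flec] is a product of three derivatives of [u]. Stated for an abstract degree, to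
    serve X, Y and Z alike. *)
Lemma flec_degree (R : comNzRingType) (deg : {poly {poly R}} -> nat) (u : {poly {poly R}}) n :
  (forall p q m, (deg p <= m)%N -> (deg q <= m)%N -> (deg (p + q)%R <= m)%N) ->
  (forall p, deg (- p)%R = deg p) ->
  (forall p q, (deg (p * q)%R <= (deg p + deg q).-1)%N) ->
  (forall p, (deg p^`() <= deg p)%N) -> (forall p, (deg (derivY p) <= deg p)%N) ->
  (deg u <= n.+1)%N -> (deg (flec u) <= (3 * n).+1)%N.
Proof.
move=> dD dN dM dX dY un.
have dM3 a b c : (deg a <= n.+1)%N -> (deg b <= n.+1)%N -> (deg c <= n.+1)%N ->
    (deg (a * (b * c))%R <= (3 * n).+1)%N.
  by move=> an bn cn; have := dM a (b * c); have := dM b c; lia.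
have uX := leq_trans (dX u) un; have uY := leq_trans (dY u) un.
have uXX := leq_trans (dX _) uX; have uYY := leq_trans (dY _) uY.
have uXY := leq_trans (dY _) uX.
rewrite /flec; apply: (dD); last exact: dM3.
apply: (dD); first exact: dM3.
by rewrite dN mulr_natl mulr2n -mulrA; apply: (dD); apply: (dM3).
Qed.

Lemma size_flec (R : comNzRingType) (u : {poly {poly R}}) n :
  (size u <= n.+1)%N -> (size (flec u) <= (3 * n).+1)%N.
Proof.
apply: (@flec_degree R (fun p => size p)).
- by move=> p q m pm qm; rewrite (leq_trans (size_polyD _ _)) // geq_max pm.
- by move=> p; rewrite size_polyN.
- by move=> p q; apply: size_polyMleq.
- by move=> p; apply: size_deriv_le.
- by move=> p; apply: size_derivY_le.
Qed.

Lemma sizeY_flec (R : comNzRingType) (u : {poly {poly R}}) n :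
  (sizeY u <= n.+1)%N -> (sizeY (flec u) <= (3 * n).+1)%N.
Proof.
apply: flec_degree.
- by move=> p q m; apply: sizeYD.
- by move=> p; rewrite !sizeYE rmorphN size_polyN.
- by move=> p q; rewrite !sizeYE rmorphM size_polyMleq.
- by move=> p; apply: sizeY_deriv_le.
- by move=> p; apply: sizeY_derivY_le.
Qed.

Lemma sizeZ_flec u n : (sizeZ u <= n.+1)%N -> (sizeZ (flec u) <= (3 * n).+1)%N.
Proof.
apply: flec_degree.
- by move=> p q m; apply: sizeZD.
- by move=> p; rewrite /sizeZ rmorphN !sizeYE rmorphN size_polyN.
- by move=> p q; rewrite /sizeZ rmorphM !sizeYE rmorphM size_polyMleq.
- by move=> p; apply: sizeZ_deriv_le.
- by move=> p; apply: sizeZ_derivY_le.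
Qed.

(** On a column X is linear in Z and Y is constant, so only the degrees in X and Z count. *)
Lemma size_horner2 u (x : {poly K}) (y : K) : (size x <= 2)%N ->
  (size u.[x, y%:P] <= ((size u).-1 + (sizeZ u).-1).+1)%N.
Proof.
move=> x2; pose v := map_poly (horner_eval y%:P) u.
have -> : u.[x, y%:P] = v.[x].
  have := horner_map (horner_eval y%:P) u x%:P.
  by rewrite /= /horner_eval hornerC => ->.
rewrite horner_coef.
apply: leq_trans (size_sum _ _ _) _; apply/bigmax_leqP=> i _.
apply: leq_trans (size_polyMleq _ _) _.
have szx : (size (x ^+ i) <= i.+1)%N.
  elim: (i : nat) => [|k IHk]; first by rewrite expr0 size_poly1.
  by rewrite exprS; apply: leq_trans (size_polyMleq _ _) _; lia.
have szi : (i <= (size u).-1)%N.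
  have := ltn_ord i; have : (size v <= size u)%N by apply: size_poly.
  lia.
have szc : (size (v`_i)%R <= (sizeZ u).-1.+1)%N.
  rewrite coef_map /=; apply: leq_trans (max_size_evalC _ _) _.
  by apply: leq_trans (leqSpred _); have /sizeZ_le := leqnn (sizeZ u); apply.
apply: leq_trans (_ : ((sizeZ u).-1.+1 + i.+1).-1 <= _)%N.
  by rewrite -subn1 -[X in (_ <= X)%N]subn1 leq_sub2r // leq_add.
by rewrite addnS /= addSn ltnS addnC leq_add2r.
Qed.

End DegreesCom.

Section DegreesIdomain.
Variable K : idomainType.
Implicit Types (u v : {poly {poly {poly K}}}).

Lemma size_mull_le (R : idomainType) (p q : {poly R}) : p * q != 0 ->
  (size p <= size (p * q)%R)%N.
Proof.
rewrite mulf_eq0 negb_or => /andP[p0 q0]; rewrite size_mul //.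
have := size_poly_gt0 q; rewrite q0; lia.
Qed.

Lemma sizeZ_mull_le u v : u * v != 0 -> (sizeZ u <= sizeZ (u * v)%R)%N.
Proof.
move=> uv0; rewrite /sizeZ rmorphM !sizeYE rmorphM; apply: size_mull_le.
rewrite -rmorphM swapXY_eq0 -rmorphM map_poly_eq0_id0 //.
by rewrite swapXY_eq0 lead_coef_eq0.
Qed.

(* Both summands are additive on products, so primes in a factorization
   share this degree between them. *)
Definition degXY (R : nzRingType) (u : {poly {poly R}}) : nat :=
  ((size u).-1 + (sizeY u).-1)%N.

Lemma degXYM (R : idomainType) (u v : {poly {poly R}}) : u != 0 -> v != 0 ->
  degXY (u * v) = (degXY u + degXY v)%N.
Proof.
move=> u0 v0; rewrite /degXY !sizeYE rmorphM !size_mul ?swapXY_eq0 //.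
move: (size_poly_gt0 u) (size_poly_gt0 v) (size_poly_gt0 (swapXY u)) (size_poly_gt0 (swapXY v)).
rewrite !swapXY_eq0 u0 v0.
by case: (size u) (size v) (size (swapXY u)) (size (swapXY v)) => [|a] [|b] [|c] [|d] //= *; lia.
Qed.

End DegreesIdomain.

Section Evaluation.
Variable R : comNzRingType.

Lemma horner_subst2 (U V : {poly R}) (u : {poly {poly R}}) t :
  (subst2 U V u).[t] = u.[U.[t], V.[t]].
Proof.
rewrite /subst2.
elim/poly_ind: u => [|u q IHu]; first by rewrite rmorph0 !horner0.
rewrite rmorphD rmorphM /= map_polyX map_polyC !hornerE IHu /=.
by rewrite horner_comp.
Qed.

Lemma horner_map2 (S : comNzRingType) (f : {rmorphism R -> S}) (u : {poly {poly R}}) x y :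
  f u.[x, y] = (map_poly (map_poly f) u).[f x, f y].
Proof. by rewrite -map_polyC horner_map horner_map. Qed.

End Evaluation.

(** * Row and column lines *)

Lemma derivY_map (R S : comNzRingType) (f : {rmorphism R -> S}) (u : {poly {poly R}}) :
  map_poly (map_poly f) (derivY u) = derivY (map_poly (map_poly f) u).
Proof. by apply/polyP=> i; rewrite !coef_map /= deriv_map. Qed.

Lemma flec_map (R S : comNzRingType) (f : {rmorphism R -> S}) (u : {poly {poly R}}) :
  map_poly (map_poly f) (flec u) = flec (map_poly (map_poly f) u).
Proof.
suff key (m : {rmorphism {poly {poly R}} -> {poly {poly S}}}) :
    (forall v, (m v)^`() = m v^`()) -> (forall v, derivY (m v) = m (derivY v)) ->
    m (flec u) = flec (m u).
  by apply: key => v; [exact: deriv_map | exact: esym (derivY_map f v)].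
move=> dX dY.
by rewrite /flec rmorphD rmorphB !rmorphM rmorph_nat !dX !dY.
Qed.

Lemma size_line (R : nzRingType) (a b : R) : (size (b%:P + a%:P * 'X)%R <= 2)%N.
Proof.
apply: leq_trans (size_polyD _ _) _; rewrite geq_max ltnW ?ltnS ?size_polyC_leq1 //=.
by rewrite mul_polyC (leq_trans (size_scale_leq _ _)) // size_polyX.
Qed.

Section Lines.
Variable K : fieldType.
Implicit Types (u v : {poly {poly {poly K}}}) (a b z : K).

Definition evalZ z u : {poly {poly K}} := map_poly (map_poly (horner_eval z)) u.

(** The second coordinate has the shape required by [flec_line], with c = 1 and d = 0; the result is
    a polynomial in Y. *)
Definition row_eval a b z u : {poly K} :=
  subst2 (b%:P + a%:P * 'X) (0%:P + 1%:P * 'X) (evalZ z u).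

(** Here the argument [z] is the value of Y and the result is a polynomial in Z. A column is thus a
    point with coordinates in K[Z], as [bezout_card] needs. *)
Definition col_eval a b z u : {poly K} := u.[b%:P + a%:P * 'X, z%:P].

Lemma col_evalM a b z u v : col_eval a b z (u * v) = col_eval a b z u * col_eval a b z v.
Proof. by rewrite /col_eval !hornerM. Qed.

Lemma col_eval1 a b z : col_eval a b z 1 = 1.
Proof. by rewrite /col_eval !hornerC. Qed.

Lemma row_evalM a b z u v : row_eval a b z (u * v) = row_eval a b z u * row_eval a b z v.
Proof. by rewrite /row_eval /evalZ rmorphM subst2M. Qed.

Lemma row_eval_flec a b z u : row_eval a b z u = 0 -> row_eval a b z (flec u) = 0.
Proof.
rewrite /row_eval => u0; have := flec_line b a 1 0 (evalZ z u).
rewrite /= u0 deriv0 deriv0 mulr0 mul0r addr0 polyC1 expr1n mul1r => <-.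
by congr (subst2 _ _ _); rewrite /evalZ flec_map.
Qed.

(** The equation says that the row and the column meet at Y = y, Z = z; both sides are the value of
    [u] there. *)
Lemma row_col_eval (a b z c d y : K) u : a * y + b = c * z + d ->
  (row_eval a b z u).[y] = (col_eval c d y u).[z].
Proof.
move=> inc; rewrite /row_eval horner_subst2.
have := horner_map2 (horner_eval z) u (d%:P + c%:P * 'X) y%:P.
rewrite /= /horner_eval -/(evalZ z u) /col_eval => ->.
by rewrite !hornerE addrC inc addrC.
Qed.

(** There are (D+1)^3 coefficients to choose. On a row [u] becomes a polynomial in Y of degree at
    most 2D, so each row imposes 2D+1 linear conditions. *)
Lemma interpolation (I : finType) (z a b : I -> K) (D : nat) :
  (#|I| * (2 * D).+1 < D.+1 ^ 3)%N ->
  exists u, [/\ u != 0, (size u <= D.+1)%N, (sizeY u <= D.+1)%N, (sizeZ u <= D.+1)%N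
    & forall i, row_eval (a i) (b i) (z i) u = 0].
Proof.
move=> ltID; pose T := ('I_D.+1 * 'I_D.+1 * 'I_D.+1)%type.
pose mono (t : T) : {poly {poly {poly K}}} := ('X^(t.2) *: 'X^(t.1.2)) *: 'X^(t.1.1).
pose M (t : T) (c : I * 'I_(2 * D).+1) :=
  (row_eval (a c.1) (b c.1) (z c.1) (mono t))`_c.2.
have [|v [[t0 vt0] vM]] := @kernel_exists K T (I * 'I_(2 * D).+1)%type M.
  by rewrite /T !card_prod !card_ord; move: ltID; rewrite !expnS expn0 muln1 mulnA.
pose u := \sum_t (v t)%:P%:P%:P * mono t.
have coefu i j k : u`_i`_j`_k =
    \sum_t v t *+ ((i == t.1.1) && (j == t.1.2) && (k == t.2)).
  rewrite !coef_sum; apply: eq_bigr => t _.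
  rewrite !coefCM !coefZ !coefXn.
  case: eqP => _; last by rewrite /= !mulr0n mulr0 !coef0 mulr0.
  rewrite mulr1 coefZ coefXn.
  case: eqP => _; last by rewrite /= !mulr0n mulr0 !coef0 mulr0.
  by rewrite mulr1 coefXn mulr_natr.
have coefu0 i j k : ~~ ((i < D.+1) && (j < D.+1) && (k < D.+1))%N -> u`_i`_j`_k = 0.
  move=> ijk; rewrite coefu big1 // => t _; case: eqP ijk => [->|]; rewrite ?ltn_ord //=.
  case: eqP => [->|]; rewrite ?ltn_ord //=.
  by case: eqP => [->|]; rewrite ?ltn_ord //=.
exists u; split.
- apply: contra_neq vt0 => u0; have := coefu t0.1.1 t0.1.2 t0.2.
  rewrite u0 !coef0 (bigD1 t0) //= !eqxx mulr1n big1 ?addr0 // => t tt0.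
  case: eqP => //= e1; case: eqP => //= e2; case: eqP => //= e3.
  case/eqP: tt0; apply/eqP; rewrite -pair_eqE /= -pair_eqE /= -!val_eqE /=.
  by rewrite e1 e2 e3 !eqxx.
- apply/leq_sizeP => i Di; apply/polyP=> j; apply/polyP=> k.
  by rewrite !coef0 coefu0 // ltnNge Di.
- apply/sizeY_le => i; apply/leq_sizeP => j Dj; apply/polyP=> k.
  by rewrite !coef0 coefu0 // [(j < _)%N]ltnNge Dj andbF.
- apply/sizeZ_le2 => i j; apply/leq_sizeP => k Dk.
  by rewrite coefu0 // [(k < _)%N]ltnNge Dk andbF.
move=> i; apply/polyP=> k; rewrite coef0.
have rowD : {morph row_eval (a i) (b i) (z i) : p q / p + q}.
  by move=> p q; rewrite /row_eval /evalZ rmorphD subst2D.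
have row0 : row_eval (a i) (b i) (z i) 0 = 0.
  by rewrite /row_eval /evalZ map_poly0 /subst2 map_poly0 horner0.
have rowE : row_eval (a i) (b i) (z i) u =
    \sum_t (v t)%:P * row_eval (a i) (b i) (z i) (mono t).
  rewrite (big_morph _ rowD row0); apply: eq_bigr => t _; rewrite row_evalM; congr (_ * _).
  by rewrite /row_eval /evalZ map_polyC subst2C /= map_polyC comp_polyC /= /horner_eval hornerC.
have [lek|ltk] := ltnP k (2 * D).+1.
  rewrite rowE coef_sum -[RHS](vM (i, Ordinal lek)).
  by apply: eq_bigr => t _; rewrite coefCM.
rewrite rowE coef_sum big1 // => t _; rewrite coefCM nth_default ?mulr0 //.
apply: leq_trans (size_subst2 _ _ _) _.
- exact: size_line.
- exact: size_line.
apply: leq_trans ltk; rewrite ltnS mul2n -addnn leq_add //.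
  rewrite -subn1 leq_subLR add1n (leq_trans (size_poly _ _)) //.
  by rewrite (leq_trans (size_scale_leq _ _)) // size_polyXn ltn_ord.
rewrite -subn1 leq_subLR add1n; apply/sizeY_le => m.
rewrite coef_map (leq_trans (size_poly _ _)) //= coefZ coefXn.
case: eqP => _; last by rewrite mulr0 size_poly0.
by rewrite mulr1 (leq_trans (size_scale_leq _ _)) // size_polyXn ltn_ord.
Qed.

End Lines.

(** * Columns on a surface swept by rows *)

Lemma poly_eq0_card (R : idomainType) (I : finType) (z : I -> R) (P : pred I)
    (q : {poly R}) m :
  injective z -> (size q <= m.+1)%N -> {in P, forall i, q.[z i] = 0} ->
  (m < #|P|)%N -> q = 0.
Proof.
move=> zI qm qP mP; apply/eqP; apply: contraTT mP => q0; rewrite -leqNgt.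
have h := card_roots_le zI q0.
apply: leq_trans (_ : #|[pred i | q.[z i] == 0%R]| <= _)%N.
  by apply: subset_leq_card; apply/subsetP=> i /qP; rewrite inE => ->.
by apply: leq_trans h _; rewrite -subn1 leq_subLR add1n.
Qed.

Lemma card_has_le (T : finType) (A : Type) (r : T -> A -> bool) (s : seq A) :
  (#|[pred j | has (r j) s]| <= \sum_(g <- s) #|[pred j | r j g]|)%N.
Proof.
elim: s => [|g s IHs].
  by rewrite big_nil leqn0; apply/eqP/eq_card0 => j; rewrite inE.
rewrite big_cons; apply: leq_trans (leq_add (leqnn _) IHs).
by rewrite -cardUI (leq_trans _ (leq_addr _ _)) //.
Qed.

Lemma degXY_prod (R : idomainType) (s : seq {poly {poly R}}) :
  {in s, forall g, g != 0} -> degXY (\prod_(g <- s) g) = (\sum_(g <- s) degXY g)%N.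
Proof.
elim: s => [|g s IHs] s0; first by rewrite !big_nil /degXY sizeYE rmorph1 size_poly1.
rewrite !big_cons degXYM ?IHs //; last 2 first.
- by apply: s0; rewrite mem_head.
- rewrite prodf_seq_neq0; apply/allP=> h hs; apply: s0; by rewrite inE hs orbT.
by move=> h hs; apply: s0; rewrite inE hs orbT.
Qed.

Lemma prime_power_split (R : idomainType) (g f : {poly {poly R}}) :
  (0 < degXY g)%N -> g != 0 -> f != 0 ->
  exists a r, f = g ^+ a * r /\ ~ divides g r.
Proof.
move=> wg g0; have [n] := ubnP (degXY f); elim: n f => // n IHn f fn f0.
case: (EM (divides g f)) => [[h fE]|]; last by exists 0, f; rewrite mul1r.
have h0 : h != 0 by apply: contra_neq f0 => h0; rewrite fE h0 mulr0.
have [|//|a [r [hE gr]]] := IHn h; last by exists a.+1, r; rewrite fE hE exprS mulrA.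
move: fn; rewrite fE degXYM //; lia.
Qed.

Lemma natr_poly_neq0 (R : nzRingType) p k : p \in [pchar R] -> (0 < k < p)%N ->
  k%:R != 0 :> {poly R}.
Proof.
move=> pR /andP[k0 kp]; have -> : k%:R = k%:R%:P :> {poly R} by rewrite polyC_natr.
rewrite polyC_eq0 -(dvdn_pcharf pR); apply/negP => /(dvdn_leq k0).
by rewrite leqNgt kp.
Qed.

Lemma deriv_neq0 (R : idomainType) p (g : {poly {poly R}}) : p \in [pchar R] ->
  (1 < size g <= p)%N -> g^`() != 0.
Proof.
move=> pR /andP[g1 gp]; apply/negP => /eqP/polyP/(_ (size g).-2); rewrite coef0 coef_deriv.
have -> : (size g).-2.+1 = (size g).-1 by case: (size g) g1 => [|[]].
rewrite -lead_coefE -mulr_natr => /eqP; rewrite mulf_eq0 lead_coef_eq0.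
rewrite -size_poly_eq0 gtn_eqF ?(ltnW g1) //=; apply/negP.
by apply: (natr_poly_neq0 pR); case: (size g) g1 gp => [|[]].
Qed.

Section Columns.
Variables (K : fieldType) (p : nat) (I J : finType).
Variables (z a b : I -> K) (y c d : J -> K) (D : nat).
Hypotheses (pK : p \in [pchar K]) (Dp : (2 * D < p)%N).
Hypotheses (z_inj : injective z) (y_inj : injective y).

Local Notation col j := (col_eval (c j) (d j) (y j)).
Local Notation row i := (row_eval (a i) (b i) (z i)).

Let yP_inj : injective (fun j => (y j)%:P).
Proof. by move=> i j /polyC_inj/y_inj. Qed.

(** Columns are points over K[Z] with distinct constant Y-coordinates, so [bezout_card] counts the
    columns lying on both surfaces. *)
Lemma bezout_col (g h : {poly {poly {poly K}}}) m :
  (1 < size g)%N -> prime_elt g -> ~ divides g h ->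
  (size h <= m.+1)%N -> (sizeY h <= m.+1)%N ->
  (#|[pred j | (col j g == 0%R) && (col j h == 0%R)]| <= m * degXY g)%N.
Proof.
move=> g1 gP gh hm hm'.
apply: leq_trans (@bezout_card _ J (fun j => (d j)%:P + (c j)%:P * 'X) _ yP_inj _ _ g1 gP gh) _.
have hX : ((size h).-1 <= m)%N by rewrite -subn1 leq_subLR add1n.
have hY : ((sizeY h).-1 <= m)%N by rewrite -subn1 leq_subLR add1n.
rewrite /degXY mulnDr addnC; apply: leq_add; last exact: leq_mul.
by rewrite mulnC; apply: leq_mul.
Qed.

Lemma size_col_eval (u : {poly {poly {poly K}}}) n j :
  (size u <= n.+1)%N -> (sizeZ u <= n.+1)%N -> (size (col j u) <= (2 * n).+1)%N.
Proof.
move=> uX uZ; apply: leq_trans (size_horner2 _ _ (size_line _ _)) _.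
by rewrite ltnS mul2n -addnn leq_add // -subn1 leq_subLR add1n.
Qed.

Hypothesis inc_many : forall j,
  (8 * D < #|[pred i | (a i * y j + b i == c j * z i + d j)%R]|)%N.

Lemma col_eq0 (u : {poly {poly {poly K}}}) :
  (size u <= D.+1)%N -> (sizeZ u <= D.+1)%N -> (forall i, row i u = 0) ->
  forall j, col j u = 0.
Proof.
move=> uX uZ u0 j.
apply: (@poly_eq0_card _ _ z [pred i | (a i * y j + b i == c j * z i + d j)%R] _ (2 * D)) => //.
- exact: size_col_eval.
- by move=> i; rewrite inE => /eqP inc; rewrite -(row_col_eval u inc) u0 horner0.
by apply: leq_ltn_trans (inc_many j); lia.
Qed.

(** On the column [r] has at most 2D zeros, so more than 6D of its 8D incidences avoid r = 0. The
    rows through these lie in f = 0 but not in r = 0, hence in g = 0, and [flec g] vanishes on them.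
    As [flec g] has degree at most 6D on the column, it is zero there. *)
Lemma col_flec_eq0 (g r f : {poly {poly {poly K}}}) k j :
  (size f <= D.+1)%N -> (sizeZ f <= D.+1)%N -> (forall i, row i f = 0) ->
  f != 0 -> f = g ^+ k.+1 * r -> col j r != 0 -> col j (flec g) = 0.
Proof.
move=> fX fZ f0 fn0 fE rj.
have fE' : f = g * (g ^+ k * r) by rewrite fE exprS mulrA.
have gr0 : g ^+ k.+1 * r != 0 by rewrite -fE.
have gX : (size g <= D.+1)%N by apply: leq_trans fX; rewrite fE' size_mull_le // -fE'.
have gZ : (sizeZ g <= D.+1)%N by apply: leq_trans fZ; rewrite fE' sizeZ_mull_le // -fE'.
have rX : (size r <= D.+1)%N by apply: leq_trans fX; rewrite fE mulrC size_mull_le // mulrC.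
have rZ : (sizeZ r <= D.+1)%N by apply: leq_trans fZ; rewrite fE mulrC sizeZ_mull_le // mulrC.
pose P := [pred i | (a i * y j + b i == c j * z i + d j)%R].
pose P1 := [pred i in P | (col j r).[z i] == 0].
pose P2 := [pred i in P | (col j r).[z i] != 0].
have cP : (#|P| <= #|P1| + #|P2|)%N.
  rewrite -cardUI (leq_trans _ (leq_addr _ _)) //.
  by apply: subset_leq_card; apply/subsetP => i; rewrite !inE => ->; rewrite orbN.
have cP1 : (#|P1| <= 2 * D)%N.
  rewrite leqNgt; apply/negP => h; case/eqP: rj.
  apply: (@poly_eq0_card _ _ z P1 _ (2 * D)) => //.
    exact: size_col_eval.
  by move=> i; rewrite !inE => /andP[_ /eqP].
apply: (@poly_eq0_card _ _ z P2 _ (6 * D)) => //.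
- by have := size_col_eval j (size_flec gX) (sizeZ_flec gZ); rewrite mulnA.
- move=> i; rewrite !inE => /andP[/eqP inc ri].
  rewrite -(row_col_eval _ inc) row_eval_flec ?horner0 //.
  have rowr : row i r != 0.
    by apply: contra_neq ri => r0; rewrite -(row_col_eval _ inc) r0 horner0.
  have := f0 i; rewrite fE; elim: (k.+1) => [|m IHm].
    by rewrite mul1r => r0; rewrite r0 eqxx in rowr.
  rewrite exprS -mulrA row_evalM => /eqP; rewrite mulf_eq0 => /orP[/eqP //|/eqP].
  exact: IHm.
rewrite -(ltn_add2l (2 * D)) -mulnDl; apply: leq_trans (inc_many j) _.
by apply: leq_trans cP _; rewrite leq_add2r.
Qed.

(* If d^2X/dY^2 vanishes along g = 0, then g = 0 is a family of lines in the
   (X, Y)-planes, since in characteristic p > deg g a power series with zero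
   second derivative is linear up to order p. *)
Lemma flat_prime_line (g q : {poly {poly {poly K}}}) j :
  prime_elt g -> flec g = g * q -> (size g <= D.+1)%N -> (sizeY g <= D.+1)%N ->
  col j g = 0 -> col j g^`() != 0 ->
  exists (s t : {poly K}), t != 0 /\ forall j', col j' g = 0 ->
    t * ((d j')%:P + (c j')%:P * 'X - ((d j)%:P + (c j)%:P * 'X)) =
    s * ((y j')%:P - (y j)%:P).
Proof.
move=> gP flecE gX gY gj gXj.
set x0 := (d j)%:P + (c j)%:P * 'X; set y0 := (y j)%:P.
(* The direction (s, t) is tangent to g = 0 at the column, so [g] restricted to the line in this
   direction vanishes to second order. *)
set t := col j g^`() in gXj; set s := - col j (derivY g).
exists s, t; split=> // j' gj'.
apply: (prime_line gP gXj) gj'.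
set U := x0%:P + s%:P * 'X; set V := y0%:P + t%:P * 'X.
have U0 : U.[0] = x0 by rewrite /U !hornerE.
have V0 : V.[0] = y0 by rewrite /V !hornerE.
have s0 u : (subst2 U V u)`_0 = col j u by rewrite -horner_coef0 horner_subst2 U0 V0.
have dU : U^`() = s%:P by rewrite derivD derivM !derivC derivX mul0r !add0r mulr1.
have dV : V^`() = t%:P by rewrite derivD derivM !derivC derivX mul0r !add0r mulr1.
have := flec_line x0 s t y0 g; rewrite /= -/U -/V flecE subst2M.
set G := subst2 U V g => eqG.
(* Since [flec g] is a multiple of [g], [flec_line] has a multiple of G on the left. *)
apply: (ode_eq0 (etrans (esym eqG) (mulrCA _ _ _))).
- by rewrite -horner_coef0 horner_exp horner_coef0 s0 expf_neq0.
- by rewrite s0.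
- have : G^`()`_0 = 0.
    rewrite /G deriv_subst2 dU dV coefD -!horner_coef0 !hornerM !hornerC !horner_coef0 !s0.
    by rewrite -/t /s mulrN mulrC addNr.
  by rewrite coef_deriv mulr1n.
(* G has degree at most 2D, which is below p. *)
move=> k /andP[k0 kG]; apply: (natr_poly_neq0 pK); rewrite k0 /=.
apply: leq_ltn_trans Dp; rewrite -ltnS; apply: leq_trans kG _.
apply: leq_trans (size_subst2 g (size_line s x0) (size_line t y0)) _.
by rewrite ltnS mul2n -addnn leq_add // -subn1 leq_subLR add1n.
Qed.

Variable B : nat.
Hypothesis B_gt0 : (0 < B)%N.
Hypothesis bilinear_few : forall k1 k2 k3 k4 : K,
  (#|[pred j | ((c j == k1 * y j + k3) && (d j == k2 * y j + k4))%R]| <= B)%N.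

(** Two distinct columns on the line determine its slope. Comparing coefficients of Z then makes [c]
    and [d] affine functions of [y], so all columns lie on one bilinear surface. *)
Lemma few_on_line (g : {poly {poly {poly K}}}) j (s t : {poly K}) : t != 0 ->
  (forall j', col j' g = 0 ->
    t * ((d j')%:P + (c j')%:P * 'X - ((d j)%:P + (c j)%:P * 'X)) =
    s * ((y j')%:P - (y j)%:P)) ->
  (#|[pred j' | col j' g == 0%R]| <= B)%N.
Proof.
move=> t0 line.
have [/existsP[j1 /andP[/eqP gj1 j1j]]|] := boolP [exists j1, (col j1 g == 0) && (j1 != j)].
  pose e := (y j1 - y j)^-1.
  have e0 : y j1 - y j != 0 by rewrite subr_eq0; apply: contra_neq j1j => /y_inj.
  apply: leq_trans (bilinear_few (e * (c j1 - c j)) (e * (d j1 - d j))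
    (c j - e * (c j1 - c j) * y j) (d j - e * (d j1 - d j) * y j)).
  apply: subset_leq_card; apply/subsetP=> j2; rewrite !inE => /eqP gj2.
  have L1 := line _ gj1; have L2 := line _ gj2.
  have : (y j1 - y j)%:P * ((d j2)%:P + (c j2)%:P * 'X - ((d j)%:P + (c j)%:P * 'X)) =
    (y j2 - y j)%:P * ((d j1)%:P + (c j1)%:P * 'X - ((d j)%:P + (c j)%:P * 'X)).
    apply: (mulfI t0); rewrite mulrCA L2 [RHS]mulrCA L1 !polyCB; ring.
  move=> /polyP E; have := E 0; have := E 1%N.
  rewrite !(coefCM, coefD, coefN, coefC, coefX) /= !(mulr1, mulr0, addr0, add0r) => E1 E0.
  apply/andP; split; apply/eqP; apply: (mulfI e0).
    rewrite -[LHS](subrK ((y j1 - y j) * c j)) -mulrBr E1 /e; field; exact: e0.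
  rewrite -[LHS](subrK ((y j1 - y j) * d j)) -mulrBr E0 /e; field; exact: e0.
move=> /existsPn h; apply: leq_trans B_gt0; rewrite -(card1 j).
apply: subset_leq_card; apply/subsetP=> j2; rewrite !inE => gj2.
by have := h j2; rewrite gj2 /= negbK.
Qed.

(** Each factor [g] is allowed [5 * D + B] columns per unit of [degXY g]. This covers the columns
    shared with r = 0 (D) and with flec g = 0 (3D), those where g_X vanishes (D), and those on a
    bilinear surface (B). A factor exceeding the allowance divides [flec g], hence is ruled by
    lines, and then has at most B columns. *)
Theorem few_columns : (#|I| * (2 * D).+1 < D.+1 ^ 3)%N ->
  (#|J| <= 2 * D * (5 * D + B))%N.
Proof.
move=> ID.
have [f [f0 fX fY fZ frow]] := interpolation z a b ID.
have fcol := col_eq0 fX fZ frow.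
have := factorial_poly (factorial_poly (factorial_poly (@factorial_field K))) f0.
move=> [u [s [uu sP fE]]].
pose mu := (5 * D + B)%N.
have s0 : {in s, forall g, g != 0} by move=> g /sP[].
have ps0 : \prod_(g <- s) g != 0.
  by apply: contra_neq f0 => h; rewrite fE h mulr0.
have u0 : u != 0 by apply: contraTneq uu => ->; rewrite unitr0.
rewrite leqNgt; apply/negP => Jbig.
(* Pigeonhole weighted by [degXY], which adds up to at most 2D over the factors of [f]. *)
have [g gs Jg] : exists2 g, g \in s & (mu * degXY g < #|[pred j | col j g == 0%R]|)%N.
  apply/not_exists2P => small; move: Jbig; rewrite ltnNge => /negP; apply.
  have : (#|J| <= #|[pred j | has (fun g => col j g == 0%R) s]|)%N.
    apply: subset_leq_card; apply/subsetP=> j _; rewrite inE.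
    have : col j (u * \prod_(g <- s) g) == 0 by rewrite -fE fcol.
    rewrite col_evalM mulf_eq0 => /orP[cu|].
      have := col_eval1 (c j) (d j) (y j); rewrite -(divrr uu) col_evalM (eqP cu) mul0r.
      by move/esym/eqP; rewrite oner_eq0.
    elim: (s) => [|h s' IHs]; first by rewrite big_nil col_eval1 oner_eq0.
    by rewrite big_cons col_evalM mulf_eq0 /= => /orP[->//|/IHs ->]; rewrite orbT.
  move=> /leq_trans -> //; apply: leq_trans (card_has_le _ _) _.
  apply: (@leq_trans (\sum_(g <- s) mu * degXY g)).
    rewrite big_seq [X in (_ <= X)%N]big_seq; apply: leq_sum => g gs.
    by have [//|] := small g; move=> /negP; rewrite -leqNgt.
  rewrite -big_distrr /= -degXY_prod // mulnC leq_mul //.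
  apply: (@leq_trans (degXY f)); first by rewrite fE degXYM // leq_addl.
  rewrite /degXY mul2n -addnn leq_add // -subn1 leq_subLR add1n //.
have gP := sP _ gs; have g0 := s0 _ gs.
have [f' ff'] : divides g f.
  by rewrite fE; apply: dividesMl; exists (\prod_(h <- rem g s) h); rewrite (big_rem g).
have gX : (size g <= D.+1)%N by apply: leq_trans fX; rewrite ff' size_mull_le // -ff'.
have gY : (sizeY g <= D.+1)%N.
  by apply: leq_trans fY; rewrite ff' !sizeYE rmorphM size_mull_le // -rmorphM swapXY_eq0 -ff'.
(* If [g] is free of X, the Y-coordinate of each of its columns is a root of [g], which leaves at
   most [degXY g] columns. *)
have g1 : (1 < size g)%N.
  rewrite ltnNge; apply/negP => /size1_polyC gC; move: Jg; rewrite ltnNge => /negP; apply.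
  have q0 : g`_0 != 0 by apply: contra_neq g0 => h; rewrite gC h.
  apply: leq_trans (_ : #|[pred j | (g`_0).[(y j)%:P] == 0%R]| <= _)%N.
    by apply: subset_leq_card; apply/subsetP=> j; rewrite !inE {1}gC /col_eval hornerC.
  apply: leq_trans (card_roots_le yP_inj q0) _.
  apply: (@leq_trans (degXY g)); last by rewrite leq_pmull // /mu addn_gt0 B_gt0 orbT.
  apply: leq_trans (leq_addl _ _); rewrite -!subn1 leq_sub2r //; exact: max_size_coefXY.
have wg : (0 < degXY g)%N by rewrite /degXY addn_gt0 -subn1 subn_gt0 g1.
have [k [r [fE' gr]]] := prime_power_split wg g0 f0.
have [k0|k0] := posnP k; first by case: gr; exists f'; rewrite -ff' fE' k0 mul1r.
have kE : f = g ^+ k.-1.+1 * r by rewrite prednK.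
have rfE : f = r * g ^+ k by rewrite mulrC.
have rX : (size r <= D.+1)%N by apply: leq_trans fX; rewrite rfE size_mull_le // -rfE.
have rY : (sizeY r <= D.+1)%N.
  by apply: leq_trans fY; rewrite rfE !sizeYE rmorphM size_mull_le // -rmorphM swapXY_eq0 -rfE.
have few_r := bezout_col g1 gP gr rX rY.
have Jsplit h : (#|[pred j | col j g == 0%R]| <=
    #|[pred j | (col j g == 0%R) && (col j h == 0%R)]| +
    #|[pred j | (col j g == 0%R) && (col j h != 0%R)]|)%N.
  rewrite -cardUI (leq_trans _ (leq_addr _ _)) //.
  by apply: subset_leq_card; apply/subsetP => j; rewrite !inE => ->; rewrite /= orbN.
have flecg : divides g (flec g).
  apply: contrapT => gflec.
  have few_f := bezout_col g1 gP gflec (size_flec gX) (sizeY_flec gY).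
  have sub : (#|[pred j | (col j g == 0%R) && (col j r != 0%R)]| <=
      #|[pred j | (col j g == 0%R) && (col j (flec g) == 0%R)]|)%N.
    apply: subset_leq_card; apply/subsetP => j; rewrite !inE => /andP[-> rj] /=.
    by apply/eqP; apply: col_flec_eq0 fX fZ frow f0 kE rj.
  have := leq_trans Jg (leq_trans (Jsplit r) (leq_add few_r (leq_trans sub few_f))).
  by rewrite ltnNge -mulnDl leq_mul2r /mu; lia.
have [q flecE] := flecg.
have gder : ~ divides g g^`().
  case=> h hE; have := lt_size_deriv g0; rewrite hE ltnNge => /negP; apply.
  apply: size_mull_le; rewrite -hE; apply: (deriv_neq0 (p := p)).
    by rewrite pchar_poly.
  by rewrite g1 (leq_trans gX) //; lia.
have few_d := bezout_col g1 gP gder (leq_trans (size_deriv_le _) gX)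
  (leq_trans (sizeY_deriv_le _) gY).
have : (0 < #|[pred j | (col j g == 0%R) && (col j g^`() != 0%R)]|)%N.
  rewrite lt0n; apply/eqP => c0; have := leq_trans Jg (Jsplit g^`()).
  by rewrite c0 addn0 => /leq_trans/(_ few_d); rewrite ltnNge leq_mul2r /mu; lia.
case/card_gt0P=> j; rewrite inE => /andP[/eqP gj gXj].
have [s' [t [t0 line]]] := flat_prime_line gP flecE gX gY gj gXj.
have := leq_trans Jg (few_on_line t0 line); rewrite ltnNge => /negP; apply.
by apply: leq_trans (leq_addl (5 * D) B) _; rewrite leq_pmulr.
Qed.

End Columns.

(** * Incidences of lines on a grid *)

(** Discard an element with the least value until [s] are left; the average never drops. *)
Lemma rich_subset (T : finType) (f : T -> nat) s : (s <= #|T|)%N ->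
  exists A : {set T}, #|A| = s /\ (s * (\sum_x f x) <= #|T| * (\sum_(x in A) f x))%N.
Proof.
move=> sT; have [n Ts] : exists n, (#|T| - s = n)%N by exists (#|T| - s)%N.
elim: n s sT Ts => [|n IHn] s sT.
  move=> /eqP; rewrite subn_eq0 => Ts; exists setT.
  have -> : s = #|T| by apply/eqP; rewrite eqn_leq sT.
  by rewrite cardsT; split=> //; under [X in (_ <= _ * X)%N]eq_bigl do rewrite inE.
move=> Ts; have ltsT : (s < #|T|)%N by rewrite -subn_gt0 Ts.
have [|A [cA fA]] := IHn s.+1 ltsT; first by rewrite subnS Ts.
have /card_gt0P[x0 x0A] : (0 < #|A|)%N by rewrite cA.
have [x xA0 xmin] := arg_minnP f x0A; have xA : x \in A := xA0.
exists (A :\ x); split; first by have := cardsD1 x A; rewrite xA cA => -[].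
have fAx : (\sum_(y in A) f y = f x + \sum_(y in A :\ x) f y)%N.
  rewrite (bigD1 x) //=; congr (_ + _)%N; apply: eq_bigl => y; by rewrite !inE andbC.
have : (s.+1 * f x <= \sum_(y in A) f y)%N.
  by rewrite -cA -sum_nat_const; apply: leq_sum => y /xmin.
by move: fA; rewrite fAx; nia.
Qed.

Lemma card_sum_nat (T : finType) (P : pred T) :
  #|[pred x | P x]| = (\sum_x (P x : nat))%N.
Proof. by rewrite -sum1_card big_mkcond; apply: eq_bigr => x _; rewrite inE; case: (P x). Qed.

Section Grid.
Variables (F K : fieldType) (iota : {rmorphism F -> K}) (t : K) (p : nat).
Hypothesis pK : p \in [pchar K].
Hypothesis t_free : forall a0 a1 a2 a3 : F,
  iota a0 + iota a1 * t + iota a2 * t ^+ 2 + iota a3 * t ^+ 3 = 0 ->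
  [/\ a0 = 0, a1 = 0, a2 = 0 & a3 = 0].
Variables (L S : finType) (m k : L -> F) (sg : S -> F).
Hypothesis m0 : forall l, m l != 0.
Hypothesis mk_inj : forall l l', m l = m l' -> k l = k l' -> l = l'.
Hypothesis sg_inj : injective sg.

Local Notation Om := (L * S)%type.
Implicit Types w : Om.

Definition incident w w' : bool :=
  m w.1 * sg w'.2 + k w.1 == m w'.1 * sg w.2 + k w'.1.

Let M w := iota (m w.1).
Let Kc w := iota (k w.1).
Let X w := iota (sg w.2).

Let rden w := 1 + t ^+ 2 * X w.
Let cden w := t * X w - 1.

Let rden0 w : rden w != 0.
Proof.
apply/eqP => h; have [|/eqP] := @t_free 1 0 (sg w.2) 0; last by rewrite oner_eq0.
by rewrite rmorph1 !rmorph0 !mul0r !addr0 mulrC.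
Qed.

Let cden0 w : cden w != 0.
Proof.
apply/eqP => h; have [|/eqP] := @t_free (-1) (sg w.2) 0 0; last by rewrite oppr_eq0 oner_eq0.
by rewrite rmorphN1 !rmorph0 !mul0r !addr0 addrC [_ * t]mulrC.
Qed.

Let t0 : t != 0.
Proof.
apply/eqP => h; have [|_ /eqP] := @t_free 0 1 0 0; last by rewrite oner_eq0.
by rewrite h !rmorph0 !mul0r mulr0 !addr0.
Qed.

(* The terms in t make row_z and col_y injective in w = (l, x). *)
Definition row_z w := (M w + t * Kc w) / rden w.
Definition row_a w := X w / rden w.
Definition row_b w := Kc w / rden w.
Definition col_y w := (M w - t ^+ 2 * Kc w) / cden w.
Definition col_c w := X w / cden w.
Definition col_d w := - Kc w / cden w.

(** Over the common denominator the terms in [t] cancel, leaving the difference of the two sides of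
    [incident]. *)
Lemma incidentE w w' :
  incident w w' = (row_a w * col_y w' + row_b w == col_c w' * row_z w + col_d w').
Proof.
rewrite /incident -(inj_eq (fmorph_inj iota)) !rmorphD !rmorphM /=.
rewrite -/(M w) -/(M w') -/(Kc w) -/(Kc w') -/(X w) -/(X w').
have r0 := rden0 w; have c0 := cden0 w'.
have E : row_a w * col_y w' + row_b w - (col_c w' * row_z w + col_d w') =
    (M w' * X w + Kc w' - (M w * X w' + Kc w)) / (rden w * cden w').
  rewrite /row_a /col_y /row_b /col_c /row_z /col_d /rden /cden in r0 c0 *.
  by field; rewrite r0 c0.
rewrite -[RHS]subr_eq0 E mulf_eq0 invr_eq0 mulf_eq0 (negPf r0) (negPf c0) !orbF.
by rewrite subr_eq0 eq_sym.
Qed.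

Let same w w' : m w.1 = m w'.1 -> k w.1 = k w'.1 ->
  m w.1 * sg w'.2 - m w'.1 * sg w.2 = 0 -> w = w'.
Proof.
case: w w' => [l s] [l' s'] /= em ek; rewrite -em (mk_inj em ek) -mulrBr => /eqP.
by rewrite mulf_eq0 (negPf (m0 _)) subr_eq0 => /eqP/sg_inj ->.
Qed.

(** Cross-multiplied, the equality is a cubic relation in [t] over F; its coefficients identify
    slope, intercept and abscissa. *)
Lemma row_z_inj : injective row_z.
Proof.
move=> w w' /eqP; rewrite /row_z eqr_div // -subr_eq0 => /eqP E.
have [|em ek es _] := @t_free (m w.1 - m w'.1) (k w.1 - k w'.1)
  (m w.1 * sg w'.2 - m w'.1 * sg w.2) (k w.1 * sg w'.2 - k w'.1 * sg w.2).
  by rewrite !rmorphB !rmorphM -[RHS]E /rden /M /Kc /X; ring.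
by apply: same => //; apply/eqP; rewrite -subr_eq0; apply/eqP.
Qed.

Lemma col_y_inj : injective col_y.
Proof.
move=> w w' /eqP; rewrite /col_y eqr_div // -subr_eq0 => /eqP E.
have [|em es ek _] := @t_free (m w'.1 - m w.1) (m w.1 * sg w'.2 - m w'.1 * sg w.2)
  (k w.1 - k w'.1) (k w'.1 * sg w.2 - k w.1 * sg w'.2).
  by rewrite !rmorphB !rmorphM -[RHS]E /cden /M /Kc /X; ring.
apply: same => //; apply/eqP; rewrite -subr_eq0; last exact/eqP.
by rewrite -opprB em oppr0.
Qed.

Variable B : nat.
Hypothesis B0 : (0 < B)%N.
Hypothesis few_lines : forall x y z : K, [|| x != 0, y != 0 | z != 0] ->
  (#|[pred l | (x * iota (m l) + y * iota (k l) + z == 0)%R]| <= B)%N.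

(** The surface gives two linear relations between M, Kc and X. If c t = 1 and d = 0 they fix M and
    Kc, so one line remains, with at most [#|S|] abscissae. Otherwise eliminating X gives a
    nontrivial linear relation between M and Kc, met by at most B lines, each of which determines
    X. *)
Lemma bilinear_card (a b c d : K) :
  (#|[pred w | ((col_c w == a * col_y w + c) && (col_d w == b * col_y w + d))%R]|
    <= #|S| + B)%N.
Proof.
set P := [pred w | _].
have PE w : w \in P -> X w = a * (M w - t ^+ 2 * Kc w) + c * cden w /\
    - Kc w = b * (M w - t ^+ 2 * Kc w) + d * cden w.
  rewrite inE => /andP[/eqP h1 /eqP h2]; have c0 := cden0 w; split.
    have -> : X w = col_c w * cden w by rewrite /col_c mulfVK.
    by rewrite h1 mulrDl /col_y -mulrA mulfVK.
  have -> : - Kc w = col_d w * cden w by rewrite /col_d mulfVK.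
  by rewrite h2 mulrDl /col_y -mulrA mulfVK.
have [/andP[/eqP ct /eqP d0]|nd] := boolP ((1 - c * t == 0) && (d == 0)).
  rewrite (leq_trans _ (leq_addr _ _)) // -(@card_in_image _ _ snd P).
    exact: max_card.
  move=> w w' /PE[w1 w2] /PE[w1' w2'] eqs.
  have [u1 u1'] : a * (M w - t ^+ 2 * Kc w) = c /\ a * (M w' - t ^+ 2 * Kc w') = c.
    have f v : X v = a * (M v - t ^+ 2 * Kc v) + c * cden v ->
       a * (M v - t ^+ 2 * Kc v) = c.
      move=> h; have -> : a * (M v - t ^+ 2 * Kc v) = X v - c * cden v by rewrite {1}h addrK.
      transitivity ((1 - c * t) * X v + c); first by rewrite /cden; ring.
      by rewrite ct mul0r add0r.
    by split; apply: f.
  have a0 : a != 0.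
    apply/eqP => a0; move: ct; rewrite -u1 a0 !mul0r subr0 => /eqP.
    by rewrite oner_eq0.
  have eu : M w - t ^+ 2 * Kc w = M w' - t ^+ 2 * Kc w' by apply: (mulfI a0); rewrite u1.
  have ek : Kc w = Kc w' by apply: oppr_inj; rewrite w2 w2' d0 eu !mul0r.
  have em : M w = M w' by move: eu; rewrite ek => /addIr.
  apply: same; [exact: (fmorph_inj iota)|exact: (fmorph_inj iota)|].
  by rewrite eqs (fmorph_inj iota em) subrr.
rewrite (leq_trans _ (leq_addl _ _)) //.
pose e := (1 - c * t) * b + d * t * a.
have nz : [|| - e != 0, t ^+ 2 * e - (1 - c * t) != 0 | d != 0].
  apply: contraNT nd; rewrite !negb_or !negbK oppr_eq0 => /and3P[/eqP -> + ->].
  by rewrite mulr0 sub0r oppr_eq0 andbT.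
apply: leq_trans (few_lines nz); rewrite -(@card_in_image _ _ fst P).
  apply: subset_leq_card; apply/subsetP => _ /imageP[w /PE[w1 w2] ->]; rewrite inE.
  rewrite -/(M w) -/(Kc w); apply/eqP.
  have z1 : (1 - c * t) * X w = a * (M w - t ^+ 2 * Kc w) - c.
    transitivity (X w - c * cden w - c); first by rewrite /cden; ring.
    by rewrite {1}w1 addrK.
  have z2 : d * t * X w = d - Kc w - b * (M w - t ^+ 2 * Kc w).
    transitivity (d + d * cden w); first by rewrite /cden; ring.
    by rewrite w2; ring.
  transitivity ((1 - c * t) * (d * t * X w) - d * t * ((1 - c * t) * X w)); last by ring.
  by rewrite z1 z2 /e; ring.
move=> [l s] [l' s'] /PE[w1 w2] /PE[w1' w2'] /= el; rewrite -el in w1' w2' *.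
congr (_, _); apply: sg_inj; apply: (fmorph_inj iota).
rewrite /X /M /Kc /cden /= in w1 w2 w1' w2'.
move: nd; rewrite negb_and => /orP[ct|d0].
  have f x u : x = u + c * (t * x - 1) -> (1 - c * t) * x = u - c.
    move=> h; transitivity (x - c * (t * x - 1) - c); first by ring.
    by rewrite {1}h addrK.
  by apply: (mulfI ct); rewrite (f _ _ w1) (f _ _ w1').
apply: (mulfI t0); apply: (addIr (-1)); apply: (mulfI d0).
by apply: (addrI (b * (iota (m l) - t ^+ 2 * iota (k l)))); rewrite -w2 -w2'.
Qed.

Lemma incident_card (s : S) w :
  (#|[pred l | incident (l, s) w]| <= B)%N.
Proof.
have nz : [|| X w != 0, (1 : K) != 0 | - (M w * iota (sg s) + Kc w) != 0].
  by rewrite oner_eq0 orbT.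
apply: leq_trans (few_lines nz); apply: subset_leq_card; apply/subsetP=> l.
rewrite !inE /incident /= -(inj_eq (fmorph_inj iota)) -subr_eq0 !rmorphD !rmorphM => /eqP h.
by apply/eqP; rewrite -[RHS]h /M /X /Kc; ring.
Qed.

(** Only rows over the [s] richest abscissae are used, which keeps interpolation affordable. Columns
    with at most 8D incidences account for at most half of the total, by the assumed lower bound;
    the others are few by [few_columns] and carry at most s B incidences each. *)
Theorem grid_incidences D s : (2 * D < p)%N -> (0 < s <= #|S|)%N ->
  (#|L| * s * (2 * D).+1 < D.+1 ^ 3)%N ->
  (16 * D * #|L| * #|S| ^ 2 <= s * \sum_w #|[pred w' | incident w w']|)%N ->
  (\sum_w #|[pred w' | incident w w']|
    <= 4 * D * #|S| * B * (5 * D + (#|S| + B)))%N.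
Proof.
move=> Dp /andP[s0 sS] sD Ebig; set E := (\sum_w _)%N in Ebig *.
pose f (x : S) := (\sum_(l : L) #|[pred w' | incident (l, x) w']|)%N.
have Ef : E = (\sum_x f x)%N.
  rewrite /E /f exchange_big pair_big /=; by apply: eq_bigr => -[].
have [A [cA fA]] := rich_subset f sS.
pose T := {x : S | x \in A}.
have cT : #|{: T}| = s by rewrite card_sig -cA; apply: eq_card => x; rewrite inE.
pose em (i : L * T) : Om := (i.1, val i.2).
have em_inj : injective em by move=> [l x] [l' x'] [-> /val_inj ->].
pose inc w := #|[pred i | incident (em i) w]|.
pose J := {w : Om | (8 * D < inc w)%N}.
have E0 : (\sum_(x in A) f x = \sum_w inc w)%N.
  have -> : (\sum_(x in A) f x = \sum_(i : L * T) #|[pred w' | incident (em i) w']|)%N.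
    rewrite -(pair_big predT predT (fun l (x : T) => #|[pred w' | incident (l, val x) w']|)) /=.
    by rewrite [RHS]exchange_big; apply: (big_sub (mem A) f).
  transitivity (\sum_(i : L * T) \sum_w (incident (em i) w : nat))%N.
    by apply: eq_bigr => i _; apply: card_sum_nat.
  by rewrite exchange_big; apply: eq_bigr => w _; rewrite /inc card_sum_nat.
have incB w : (inc w <= s * B)%N.
  rewrite /inc card_sum_nat.
  rewrite -(pair_big predT predT (fun l x => (incident (em (l, x)) w : nat))) /=.
  rewrite exchange_big -cT -sum_nat_const; apply: leq_sum => x _.
  by rewrite -card_sum_nat; apply: incident_card.
have JB : (#|{: J}| <= 2 * D * (5 * D + (#|S| + B)))%N.
  apply: (@few_columns K p (L * T)%type J (row_z \o em) (row_a \o em) (row_b \o em)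
    (col_y \o val) (col_c \o val) (col_d \o val) D pK Dp).
  - by apply: inj_comp em_inj; exact: row_z_inj.
  - by apply: inj_comp val_inj; exact: col_y_inj.
  - move=> [w /= wJ]; apply: leq_trans wJ _; apply: subset_leq_card.
    by apply/subsetP => i; rewrite !inE incidentE.
  - by rewrite addn_gt0 B0 orbT.
  - move=> k1 k2 k3 k4; apply: leq_trans (bilinear_card k1 k2 k3 k4).
    rewrite -(card_image val_inj); apply: subset_leq_card; apply/subsetP => _ /imageP[j + ->].
    by rewrite !inE.
  - by rewrite card_prod cT.
have cJ : #|{: J}| = #|[pred w | (8 * D < inc w)%N]|.
  by rewrite card_sig; apply: eq_card => w; rewrite !inE.
have E1 : (\sum_w inc w <= #|{: J}| * (s * B) + #|{: Om}| * (8 * D))%N.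
  rewrite (bigID (fun w => 8 * D < inc w)%N) /= leq_add //.
    by rewrite cJ -sum_nat_const; apply: leq_sum.
  rewrite -sum_nat_const big_mkcond /=; apply: leq_sum => w _.
  by case: ltnP => // h.
rewrite card_prod in E1.
have : (E * s <= 2 * #|S| * (#|{: J}| * (s * B)))%N.
  have := leq_mul (leqnn #|S|) E1; rewrite -E0; move: fA Ebig; rewrite -Ef; nia.
have -> : (2 * #|S| * (#|{: J}| * (s * B)) = 2 * #|S| * #|{: J}| * B * s)%N by ring.
rewrite leq_pmul2r // => /leq_trans; apply.
have := leq_mul (leq_mul (leqnn (2 * #|S|)) JB) (leqnn B); lia.
Qed.

End Grid.

(** * Numerical inequalities *)

Section Numeric.
Local Open Scope nat_scope.

Lemma leq_double_sub3 n : 8 <= n -> n <= 2 * (n - 3).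
Proof. lia. Qed.

(* b is 2, kept as a variable so that b ^ 33 is not unfolded to a numeral. *)
Variables (b N M L E p : nat).
Hypotheses (b2 : b = 2) (N0 : 0 < N) (NM : N <= M) (NL : N ^ 2 <= 4 * L) (LN : L <= N ^ 2).
Hypotheses (Np : N ^ 13 < p ^ 8) (LE : (L * (N - 3)) ^ 2 <= E * M).
Hypothesis small : b ^ 33 * M ^ 8 <= N ^ 9.

Let b_gt0 : 0 < b. Proof. by rewrite b2. Qed.

Let bN : b ^ 33 <= N.
Proof.
have N8 : 0 < N ^ 8 by rewrite expn_gt0 N0.
rewrite -(leq_pmul2r N8) -expnS; apply: leq_trans small.
by rewrite leq_mul2l leq_exp2r // NM orbT.
Qed.

Let b_exp i j : i <= j -> b ^ i <= b ^ j.
Proof. by move=> ij; rewrite leq_pexp2l. Qed.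

Let N8 : 8 <= N.
Proof. by apply: leq_trans bN; apply: leq_trans (b_exp (_ : 3 <= 33)) => //; rewrite b2. Qed.

(** Here N = |A|, M = |S|, L counts the lines and E the incidences. With s = 2u^2 and D = 2Nu the
    interpolation condition holds for every u, while [rich] calls for u N^3 >= 2^8 M^3, which
    dictates this choice. *)
Let u := ((b ^ 8 * M ^ 3) %/ N ^ 3).+1.

Let uN_ge : b ^ 8 * M ^ 3 <= u * N ^ 3.
Proof. by apply/ltnW/ltn_ceil; rewrite expn_gt0 N0. Qed.

Let uN_le : u * N ^ 3 <= b ^ 9 * M ^ 3.
Proof.
rewrite /u mulSn; apply: leq_trans (leq_add (_ : _ <= M ^ 3) (leq_trunc_div _ _)) _.
  by rewrite leq_exp2r.
rewrite -mulSn leq_mul2r; apply/orP; right.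
have -> : b ^ 9 = b ^ 8 + b ^ 8 by rewrite expnS {1}b2 mul2n addnn.
by rewrite -addn1 leq_add2l expn_gt0 b_gt0.
Qed.

(** It suffices that 2^19 M^5 <= N^6; its eighth power is compared with the fifth power of
    [small]. *)
Let s_le : 2 * u ^ 2 <= M.
Proof.
have M0 : 0 < M := leq_trans N0 NM.
have N6 : 0 < N ^ 6 by rewrite expn_gt0 N0.
rewrite -(leq_pmul2r N6).
apply: leq_trans (_ : b ^ 19 * M ^ 6 <= _).
  have := leq_mul uN_le uN_le.
  have -> : 2 * u ^ 2 * N ^ 6 = b * ((u * N ^ 3) * (u * N ^ 3)) by rewrite b2; ring.
  have -> : b ^ 19 * M ^ 6 = b * ((b ^ 9 * M ^ 3) * (b ^ 9 * M ^ 3)) by ring.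
  by rewrite leq_mul2l => ->; rewrite orbT.
rewrite [M ^ 6]expnS mulnCA leq_mul2l; apply/orP; right.
rewrite -(leq_exp2r _ _ (isT : 0 < 8)) expnMn -!expnM.
have h5 : b ^ 165 * M ^ 40 <= N ^ 45.
  have := leq_exp2r (b ^ 33 * M ^ 8) (N ^ 9) (isT : 0 < 5).
  by rewrite small expnMn -!expnM.
apply: leq_trans (_ : b ^ 165 * M ^ 40 <= _).
  by rewrite leq_mul2r b_exp ?orbT.
by apply: leq_trans h5 _; rewrite leq_pexp2l.
Qed.

Let D := 2 * N * u.

(** Otherwise p N^2 <= 2^11 M^3; the eighth power of this and the cube of [small] give p^8 N^16 <=
    N^27, contrary to N^13 < p^8. *)
Let D_lt : 2 * D < p.
Proof.
rewrite ltnNge; apply/negP => pD.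
have : p * N ^ 2 <= b ^ 11 * M ^ 3.
  have N2 : 0 < N ^ 2 by rewrite expn_gt0 N0.
  apply: leq_trans (_ : 2 * D * N ^ 2 <= _); first by rewrite leq_mul2r pD orbT.
  have -> : 2 * D * N ^ 2 = b ^ 2 * (u * N ^ 3) by rewrite /D b2; ring.
  have -> : b ^ 11 * M ^ 3 = b ^ 2 * (b ^ 9 * M ^ 3) by ring.
  by rewrite leq_mul2l uN_le orbT.
move=> h0; have : (p * N ^ 2) ^ 8 <= (b ^ 11 * M ^ 3) ^ 8 by rewrite leq_exp2r.
rewrite (expnMn p) (expnMn (b ^ 11)) -!expnM => h.
have h3 : b ^ 99 * M ^ 24 <= N ^ 27.
  have := leq_exp2r (b ^ 33 * M ^ 8) (N ^ 9) (isT : 0 < 3).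
  by rewrite small expnMn -!expnM.
have : N ^ 13 * N ^ 16 < p ^ 8 * N ^ 16 by rewrite ltn_mul2r expn_gt0 N0.
rewrite ltnNge => /negP; apply; apply: leq_trans h _.
apply: leq_trans (_ : b ^ 99 * M ^ 24 <= _); first by rewrite leq_mul2r b_exp ?orbT.
by apply: leq_trans h3 _; rewrite -expnD leq_pexp2l.
Qed.

Let D_box : L * (2 * u ^ 2) * (2 * D).+1 < D.+1 ^ 3.
Proof.
have h : 2 * (L * (2 * u ^ 2)) <= D ^ 2.
  have -> : D ^ 2 = N ^ 2 * (4 * u ^ 2) by rewrite /D; ring.
  have -> : 2 * (L * (2 * u ^ 2)) = L * (4 * u ^ 2) by ring.
  by rewrite leq_mul2r LN orbT.
rewrite -(ltn_pmul2l (isT : 0 < 2)) mulnA.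
apply: leq_ltn_trans (leq_mul h (leqnn _)) _.
have -> : 2 * D.+1 ^ 3 = D ^ 2 * (2 * D).+1 + (5 * D ^ 2 + 6 * D + 2) by ring.
by rewrite -[X in X < _]addn0 ltn_add2l addnS.
Qed.

Let LN2 : (L * N) ^ 2 <= 4 * (E * M).
Proof.
apply: leq_trans (leq_mul (leqnn 4) LE).
have -> : 4 * (L * (N - 3)) ^ 2 = (L * (2 * (N - 3))) ^ 2 by ring.
by rewrite leq_exp2r // leq_mul2l leq_double_sub3 ?orbT.
Qed.

Let rich : 16 * D * L * M ^ 2 <= 2 * u ^ 2 * E.
Proof.
have M0 : 0 < M := leq_trans N0 NM.
rewrite -(leq_pmul2r (_ : 0 < 4 * M)); last by rewrite muln_gt0.
apply: leq_trans (_ : 2 * u ^ 2 * (L * N) ^ 2 <= _); last first.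
  have -> : 2 * u ^ 2 * E * (4 * M) = 2 * u ^ 2 * (4 * (E * M)) by ring.
  by rewrite leq_mul2l LN2 orbT.
have -> : 16 * D * L * M ^ 2 * (4 * M) = 2 * u * L * N * (64 * M ^ 3) by rewrite /D; ring.
have -> : 2 * u ^ 2 * (L * N) ^ 2 = 2 * u * L * N * (u * L * N) by ring.
rewrite leq_mul2l; apply/orP; right.
rewrite -(leq_pmul2l (isT : 0 < 4)).
have -> : 4 * (64 * M ^ 3) = b ^ 8 * M ^ 3 by rewrite b2; ring.
apply: leq_trans uN_ge _.
have -> : u * N ^ 3 = u * N * N ^ 2 by ring.
have -> : 4 * (u * L * N) = u * N * (4 * L) by ring.
by rewrite leq_mul2l NL orbT.
Qed.

(** As 5D + M + 2N <= 16 N u, the upper bound on E against E >= (L N)^2 / (4 M) and L >= N^2 / 4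
    yields N^3 <= (2^7 u M)^2. Inserting u <= 2^9 M^3 / N^3 gives N^9 <= 2^32 M^8, against
    [small]. *)
Lemma numeric_contradiction :
  (forall D s, 2 * D < p -> 0 < s <= M -> L * s * (2 * D).+1 < D.+1 ^ 3 ->
     16 * D * L * M ^ 2 <= s * E -> E <= 4 * D * M * (2 * N) * (5 * D + (M + 2 * N))) ->
  False.
Proof.
have M0 : 0 < M := leq_trans N0 NM.
have u0 : 0 < u by [].
move=> /(_ D (2 * u ^ 2) D_lt); rewrite muln_gt0 expn_gt0 u0 s_le => /(_ isT D_box rich) Ele.
have uM : 3 * M <= N * u.
  have N2 : 0 < N ^ 2 by rewrite expn_gt0 N0.
  rewrite -(leq_pmul2l N2); have -> : N ^ 2 * (N * u) = u * N ^ 3 by ring.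
  apply: leq_trans uN_ge.
  have -> : N ^ 2 * (3 * M) = 3 * (N ^ 2 * M) by ring.
  have -> : M ^ 3 = M ^ 2 * M by ring.
  by apply: leq_mul; [rewrite b2 | rewrite leq_mul2r leq_exp2r // NM orbT].
have h1 : 5 * D + (M + 2 * N) <= 16 * (N * u).
  have -> : 16 * (N * u) = 5 * D + (N * u + 5 * (N * u)) by rewrite /D; ring.
  rewrite leq_add2l; apply: leq_trans (leq_addr _ _); apply: leq_trans uM.
  by rewrite [3 * M]mulSn leq_add2l leq_mul2l NM.
have h2 : (L * N) ^ 2 <= 4 * (4 * D * M * (2 * N) * (16 * (N * u)) * M).
  apply: leq_trans LN2 _; rewrite leq_mul2l leq_mul2r; apply/orP; right; apply/orP; right.
  by apply: leq_trans Ele _; rewrite leq_mul2l h1 orbT.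
have h3 : N ^ 4 <= 16 * L ^ 2.
  have := leq_mul NL NL.
  have -> : N ^ 2 * N ^ 2 = N ^ 4 by ring.
  by have -> : 4 * L * (4 * L) = 16 * L ^ 2 by ring.
have h4 : N ^ 3 <= (b ^ 7 * u * M) ^ 2.
  rewrite -(leq_pmul2l (_ : 0 < N ^ 3)); last by rewrite expn_gt0 N0.
  have -> : N ^ 3 * N ^ 3 = N ^ 4 * N ^ 2 by ring.
  apply: leq_trans (leq_mul h3 (leqnn (N ^ 2))) _.
  have -> : 16 * L ^ 2 * N ^ 2 = 16 * (L * N) ^ 2 by ring.
  apply: leq_trans (leq_mul (leqnn 16) h2) _; rewrite /D b2.
  have -> : 16 * (4 * (4 * (2 * N * u) * M * (2 * N) * (16 * (N * u)) * M)) =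
    N ^ 3 * (2 ^ 7 * u * M) ^ 2 by ring.
  exact: leqnn.
have h5 : N ^ 9 <= b ^ 32 * M ^ 8.
  have -> : N ^ 9 = N ^ 3 * (N ^ 3 * N ^ 3) by ring.
  apply: leq_trans (leq_mul h4 (leqnn _)) _.
  have -> : (b ^ 7 * u * M) ^ 2 * (N ^ 3 * N ^ 3) = (b ^ 7 * M * (u * N ^ 3)) ^ 2 by ring.
  have -> : b ^ 32 * M ^ 8 = (b ^ 7 * M * (b ^ 9 * M ^ 3)) ^ 2 by ring.
  by rewrite leq_exp2r // leq_mul2l uN_le orbT.
have := leq_trans small h5.
rewrite leqNgt => /negP; apply.
by rewrite ltn_mul2r expn_gt0 M0 /= ltn_exp2l // b2.
Qed.

End Numeric.

(** * The lines attached to A *)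

Lemma fraction_X_free (F : fieldType) (a0 a1 a2 a3 : F) (t := tofrac ('X : {poly F})) :
  tofrac a0%:P + tofrac a1%:P * t + tofrac a2%:P * t ^+ 2 + tofrac a3%:P * t ^+ 3 = 0 ->
  [/\ a0 = 0, a1 = 0, a2 = 0 & a3 = 0].
Proof.
rewrite -!rmorphXn -!rmorphM -!rmorphD => /eqP; rewrite tofrac_eq0 => /eqP/polyP h.
have := h 0; have := h 1%N; have := h 2; have := h 3.
by rewrite !(coefD, coefCM, coefXn, coefX, coefC, coef0) /= !(mulr1, mulr0, addr0, add0r).
Qed.

Lemma sqr_sum_le (T : finType) (r : T -> nat) :
  ((\sum_x r x) ^ 2 <= #|T| * \sum_x r x ^ 2)%N.
Proof.
rewrite -(leq_pmul2l (isT : (0 < 2)%N)) expnS expn1 big_distrlr /= big_distrr /=.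
under eq_bigr => i _ do rewrite big_distrr /=.
apply: (@leq_trans (\sum_i \sum_j (r i ^ 2 + r j ^ 2))).
  by apply: leq_sum => i _; apply: leq_sum => j _; apply: nat_Cauchy.
under eq_bigr => i _ do rewrite big_split /= sum_nat_const.
by rewrite big_split /= sum_nat_const -big_distrr /= addnn mul2n.
Qed.

Lemma card_fibers_le (T U : finType) (f : T -> U) (n : nat) :
  (forall u, #|[pred x | f x == u]| <= n)%N -> (#|T| <= n * #|U|)%N.
Proof.
move=> fn; rewrite -sum1_card (partition_big f predT) //= mulnC -sum_nat_const.
by apply: leq_sum => u _; rewrite sum1_card; apply: fn.
Qed.

Section Energy.
Variables (F : fieldType) (L S : finType) (m k : L -> F) (sg : S -> F).

(** Let r(y) count the pairs (l, x) with l(x) = y. The sum of r over S is at least |L| n, and the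
    sum of r^2 counts coincidences l(x) = l'(x'); Cauchy-Schwarz compares them. *)
Lemma incidence_energy n :
  injective sg ->
  (forall l, n <= #|[pred x | [exists y, (m l * sg x + k l == sg y)%R]]|)%N ->
  ((#|L| * n) ^ 2 <= (\sum_w #|[pred w' | incident m k sg w w']|) * #|S|)%N.
Proof.
move=> sgI rich; rewrite [X in (_ <= X)%N]mulnC.
pose v (u : L * S) := m u.1 * sg u.2 + k u.1.
pose r y := #|[pred u | v u == sg y]|.
apply: (@leq_trans ((\sum_y r y) ^ 2)).
  rewrite leq_exp2r // -sum_nat_const.
  have -> : (\sum_y r y = \sum_(l : L) \sum_(x : S) \sum_y (v (l, x) == sg y))%N.
    rewrite (pair_big predT predT (fun l x => \sum_y (v (l, x) == sg y))%N) /=.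
    rewrite exchange_big /=; apply: eq_bigr => y _.
    by rewrite /r card_sum_nat; apply: eq_bigr => -[].
  apply: leq_sum => l _; apply: leq_trans (rich l) _; rewrite card_sum_nat.
  apply: leq_sum => x _; case: existsP => // -[y xy].
  by rewrite (bigD1 y) //= /v xy leq_addr.
apply: leq_trans (sqr_sum_le _) _; rewrite leq_mul2l; apply/orP; right.
have -> : (\sum_w #|[pred w' | incident m k sg w w']| =
    \sum_(u : L * S) \sum_(u' : L * S) (v u == v u'))%N.
  transitivity (\sum_(l : L) \sum_(x : S) \sum_(l' : L) \sum_(x' : S)
      (v (l, x') == v (l', x)))%N.
    rewrite (pair_big predT predT (fun l x => \sum_(l' : L) \sum_(x' : S)
      (v (l, x') == v (l', x)))%N) /=; apply: eq_bigr => w _.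
    rewrite card_sum_nat (pair_big predT predT (fun l' x' => (v (w.1, x') == v (l', w.2) : nat))%N).
    by apply: eq_bigr => -[].
  (* [incident] crosses the abscissae; exchanging x and x' uncrosses them. *)
  transitivity (\sum_(l : L) \sum_(x : S) \sum_(l' : L) \sum_(x' : S)
      (v (l, x) == v (l', x')))%N.
    apply: eq_bigr => l _; rewrite exchange_big [RHS]exchange_big /=.
    by apply: eq_bigr => l' _; rewrite exchange_big.
  rewrite (pair_big predT predT (fun l x => \sum_(l' : L) \sum_(x' : S)
      (v (l, x) == v (l', x')))%N) /=; apply: eq_bigr => -[l x] _.
  rewrite (pair_big predT predT (fun l' x' => (v (l, x) == v (l', x') : nat))%N).
  by apply: eq_bigr => -[].
apply: (@leq_trans (\sum_y \sum_u \sum_u' ((v u == sg y) && (v u' == sg y)))%N).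
  apply: leq_sum => y _; rewrite /r card_sum_nat expnS expn1 big_distrlr /=.
  by apply: leq_sum => u _; apply: leq_sum => u' _; rewrite mulnb.
rewrite exchange_big /=; apply: leq_sum => u _.
rewrite exchange_big /=; apply: leq_sum => u' _.
have [y /andP[/eqP uy /eqP vy]|h] := pickP (fun y => (v u == sg y) && (v u' == sg y)).
  rewrite uy vy eqxx (bigD1 y) //= eqxx big1 // => y' y'y.
  by rewrite (inj_eq sgI) eq_sym (negPf y'y).
by rewrite big1 // => y _; rewrite h.
Qed.

End Energy.

Section Lines.
Variables (F : fieldType) (A : {fset F}).
Hypothesis A0 : 0 \notin A.

Let nz (c : A) : val c != 0.
Proof. by apply: contraNneq A0 => <-; apply: valP. Qed.

(** For q = (c1, c2), eliminating y from X = c2 - c2^2/y, Y = c1 - c1^2/y gives this line: slope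
    (c1/c2)^2 through (c2, c1). *)
Definition line_of (q : A * A) : F * F :=
  ((val q.1 / val q.2) ^+ 2, val q.1 - (val q.1 / val q.2) ^+ 2 * val q.2).

Definition lines : {fset F * F} := [fset line_of q | q in [pred q : A * A | q.1 != q.2]].

Lemma linesP (l : lines) : exists2 q : A * A, q.1 != q.2 & val l = line_of q.
Proof. by have /imfsetP[q /= qd ->] := valP l; exists q. Qed.

Lemma lines_slope (l : lines) : (val l).1 != 0.
Proof.
by have [q _ ->] := linesP l; rewrite /= expf_neq0 // mulf_neq0 // ?invr_neq0 ?nz.
Qed.

(** For fixed c1, multiplying the relation by c2^2 gives a nonzero polynomial in c2 of degree at
    most 2, so each c1 admits at most two c2. *)
Lemma few_lines_of (K : fieldType) (iota : {rmorphism F -> K}) (x y z : K) :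
  [|| x != 0, y != 0 | z != 0] ->
  (#|[pred l : lines | (x * iota (val l).1 + y * iota (val l).2 + z == 0)%R]|
    <= 2 * #|` A|)%N.
Proof.
move=> xyz.
pose P := [pred l : lines | x * iota (val l).1 + y * iota (val l).2 + z == 0].
pose Q := [pred q : A * A | x * iota (line_of q).1 + y * iota (line_of q).2 + z == 0].
apply: (@leq_trans #|Q|).
  have [h hP] := choice (fun l => let: ex_intro2 q _ e := linesP l in ex_intro _ q e).
  rewrite -(@card_in_image _ _ h P); last first.
    by move=> l l' _ _ e; apply: val_inj; rewrite hP e -hP.
  by apply: subset_leq_card; apply/subsetP=> _ /imageP[l + ->]; rewrite !inE hP.
rewrite card_sum_nat -(pair_big predT predT (fun c1 c2 => (Q (c1, c2) : nat))) /=.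
rewrite mulnC cardfE -sum_nat_const; apply: leq_sum => c1 _; rewrite -card_sum_nat.
pose i1 := iota (val c1).
have i10 : i1 != 0 by rewrite fmorph_eq0.
pose q : {poly K} := (x * i1 ^+ 2)%:P - (y * i1 ^+ 2) *: 'X + (y * i1 + z) *: 'X^2.
have q0 : q != 0.
  apply: contraTneq xyz => q0; rewrite !negb_or !negbK.
  have qc j : q`_j = 0 by rewrite q0 coef0.
  have := qc 0; have := qc 1%N; have := qc 2.
  rewrite !(coefD, coefN, coefC, coefZ, coefX, coefXn) /=.
  rewrite !(mulr1, mulr0, addr0, add0r, subr0, sub0r, oppr0) => e2 /eqP e1 /eqP e0.
  move: e0 e1; rewrite oppr_eq0 !mulf_eq0 !(negPf i10) /= !orbF => /eqP -> /eqP y0.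
  by move: e2; rewrite y0 mul0r add0r => ->; rewrite !eqxx.
have valI : injective (fun c : A => iota (val c)).
  by move=> c c' /fmorph_inj/val_inj.
apply: leq_trans (_ : #|[pred c2 : A | q.[iota (val c2)] == 0%R]| <= _)%N.
  apply: subset_leq_card; apply/subsetP => c2; rewrite !inE /line_of /= => /eqP e.
  have i20 : iota (val c2) != 0 by rewrite fmorph_eq0.
  rewrite /q !hornerE -/i1; apply/eqP.
  transitivity (iota (val c2) ^+ 2 * 0); last by rewrite mulr0.
  rewrite -e !(rmorphB, rmorphM, rmorphXn, fmorphV) /= -/i1.
  by field.
apply: leq_trans (card_roots_le valI q0) _.
rewrite -subn1 leq_subLR /q; apply: leq_trans (size_polyD _ _) _; rewrite geq_max.
rewrite (leq_trans (size_scale_leq _ _)) ?size_polyXn // andbT.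
apply: leq_trans (size_polyD _ _) _; rewrite geq_max size_polyN.
rewrite (leq_trans (size_polyC_leq1 _)) //=.
by rewrite (leq_trans (size_scale_leq _ _)) // size_polyX.
Qed.

Lemma card_lines_le : (#|` lines| <= #|` A| ^ 2)%N.
Proof.
have [h hP] := choice (fun l => let: ex_intro2 q _ e := linesP l in ex_intro _ q e).
rewrite expnS expn1 !cardfE -card_prod; apply: (leq_card h) => l l' e.
by apply: val_inj; rewrite hP e -hP.
Qed.

(** Each line comes from at most two pairs: slope and intercept give a quadratic equation for c1,
    nonzero because c1 != c2 makes the intercept nonzero, and c1 then determines c2. *)
Lemma card_lines_ge : (#|` A| * (#|` A| - 1) <= 2 * #|` lines|)%N.
Proof.
pose T := {q : A * A | q.1 != q.2}.
have lineT (q : T) : line_of (val q) \in lines.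
  by apply/imfsetP; exists (val q) => //=; apply: (valP q).
have cT : #|{: T}| = (#|` A| * (#|` A| - 1))%N.
  rewrite card_sig card_sum_nat -(pair_big predT predT (fun c1 c2 : A => (c1 != c2 : nat))) /=.
  rewrite cardfE -sum_nat_const; apply: eq_bigr => c _; rewrite -card_sum_nat.
  have := cardC1 c; rewrite subn1 => <-; apply: eq_card => c'; by rewrite !inE eq_sym.
rewrite -cT [#|` lines|]cardfE.
apply: (card_fibers_le (f := fun q : T => [` lineT q])) => l.
pose q : {poly F} := (1 - (val l).1) *: 'X^2 - (2%:R * (val l).2) *: 'X + ((val l).2 ^+ 2)%:P.
have [[c1 c2] c12 lE] := linesP l.
have key (d1 d2 : A) : line_of (d1, d2) = val l -> q.[val d1] = 0 /\
     val d1 ^+ 2 = (val d1 - (val l).2) * val d2.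
  move=> E; rewrite /q !(hornerD, hornerN, hornerZ, hornerC, hornerX, hornerXn) -E /line_of /=.
  by split; field; apply: nz.
have l20 : (val l).2 != 0.
  rewrite lE /line_of /=; have -> : val c1 - (val c1 / val c2) ^+ 2 * val c2 =
    val c1 * (val c2 - val c1) / val c2 by field; exact: nz.
  rewrite !mulf_neq0 ?invr_neq0 ?nz // subr_eq0; apply: contra_neq c12 => /val_inj ->.
  by [].
have q0 : q != 0.
  apply: contra_neq l20 => q0; apply/eqP; rewrite -sqrf_eq0; apply/eqP.
  have : q`_0 = 0 by rewrite q0 coef0.
  by rewrite !(coefD, coefN, coefC, coefZ, coefX, coefXn) /= !mulr0 subr0 add0r.
apply: leq_trans (_ : #|[pred d1 : A | q.[val d1] == 0%R]| <= _)%N.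
  pose P := [pred x : T | [` lineT x] == l].
  have PE x : x \in P -> line_of (val x) = val l by rewrite inE => /eqP <-.
  rewrite -(@card_in_image _ _ (fun x : T => (val x).1) P).
    apply: subset_leq_card; apply/subsetP=> _ /imageP[[[d1 d2] dd] /PE /= /key[d0 _] ->].
    by rewrite inE d0.
  move=> [[d1 d2] dd] [[e1 e2] ee] /PE /= /key[_ h] /PE /= /key[_ h'] /= de.
  apply/val_inj => /=; rewrite -de in h' *; congr (_, _); apply: val_inj.
  have n0 : val d1 - (val l).2 != 0.
    apply: contraTneq (nz d1) => n0; move/eqP: h.
    by rewrite n0 mul0r expf_eq0 /= => /eqP ->; rewrite eqxx.
  by apply: (mulfI n0); rewrite -h.
apply: leq_trans (card_roots_le val_inj q0) _.
rewrite -subn1 leq_subLR /q; apply: leq_trans (size_polyD _ _) _; rewrite geq_max.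
rewrite (leq_trans (size_polyC_leq1 _)) // andbT.
apply: leq_trans (size_polyD _ _) _; rewrite geq_max size_polyN.
rewrite (leq_trans (size_scale_leq _ _)) ?size_polyXn //=.
by rewrite (leq_trans (size_scale_leq _ _)) // size_polyX.
Qed.

Local Notation S := (sumset (recip A) (recip (sumset A A))).

Definition recip_sums : {fset F} := [fset x^-1 | x in S].

(** With 0^-1 = 0 inversion is injective on all of F, even if 0 lies in the set. *)
Lemma card_recip_sums : #|` recip_sums| = #|` S|.
Proof. by rewrite card_imfset //; apply: invr_inj. Qed.

(* With y = c1 + c2 + e, the points s_i = c_i - c_i^2 / y are the reciprocals
   of 1/c1 + 1/(c2 + e) and 1/c2 + 1/(c1 + e), and (s1 - c1) / c1^2 =
   - 1/y = (s2 - c2) / c2^2. *)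
Lemma lines_rich (l : lines) :
  (#|` A| - 3 <= #|[pred x : recip_sums | [exists y : recip_sums,
     ((val l).1 * val x + (val l).2 == val y)%R]]|)%N.
Proof.
have [[c1 c2] c12 ->] := linesP l.
pose y (e : A) := val c1 + val c2 + val e.
(* The roots of this cubic are the e for which c1 + e, c2 + e or y vanishes; hence the loss of 3. *)
pose bad := ('X + (val c1)%:P) * ('X + (val c2)%:P) * ('X + (val c1 + val c2)%:P).
have mb : bad \is monic by rewrite !monicMl // monicXaddC.
have szb : size bad = 4.
  by rewrite !size_Mmonic ?monic_neq0 ?monicMl ?monicXaddC // !size_XaddC.
pose P := [pred e : A | bad.[val e] != 0].
have PE e : e \in P -> [/\ val c1 + val e != 0, val c2 + val e != 0 & y e != 0].
  rewrite inE /bad !hornerE !mulf_eq0 !negb_or => /andP[/andP[h1 h2] h3].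
  have -> : y e = val e + val c1 + val c2 by rewrite /y; ring.
  by split=> [||]; [rewrite addrC|rewrite addrC|exact: h3].
have mem (d1 d2 e : F) : d1 \in A -> d2 \in A -> e \in A -> d2 + e != 0 ->
    d1 + d2 + e != 0 -> d1 - d1 ^+ 2 / (d1 + d2 + e) \in recip_sums.
  move=> d1A d2A eA de y0; apply/imfsetP; exists (d1^-1 + (d2 + e)^-1).
    by apply/in_sumset_recip => //; exists d2, e, d1.
  have d10 : d1 != 0 by apply: contraNneq A0 => <-.
  by field; rewrite de d10 addrC addrA.
have memP e : e \in P -> val c2 - val c2 ^+ 2 / y e \in recip_sums.
  move=> /PE[h1 h2 h3]; move: h3; rewrite /y (addrC (val c1)) => h3.
  exact: mem (fsvalP c2) (fsvalP c1) (fsvalP e) h1 h3.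
pose T := {e : A | e \in P}.
pose pt (e : T) : recip_sums := [` memP _ (valP e)].
have ptI : injective pt.
  move=> e e' /(congr1 val) /= h; apply/val_inj/val_inj.
  have [_ _ y0] := PE _ (valP e); have [_ _ y0'] := PE _ (valP e').
  have : y (val e) = y (val e').
    move/addrI/oppr_inj: h => /mulfI h; apply: invr_inj; apply: h.
    by rewrite expf_neq0 // nz.
  by move/addrI.
have cT : #|{: T}| = #|P| by rewrite card_sig; apply: eq_card => x.
apply: (@leq_trans #|P|).
  have := card_roots_le (val_inj : injective (val : A -> F)) (monic_neq0 mb).
  rewrite szb => h; rewrite leq_subLR cardfE -(cardC P) addnC leq_add //.
  by apply: leq_trans h; apply: subset_leq_card; apply/subsetP=> e; rewrite !inE negbK.
rewrite -cT -(card_image ptI); apply: subset_leq_card; apply/subsetP=> _ /imageP[e _ ->].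
rewrite inE; apply/existsP.
have [h1 h2 h3] := PE _ (valP e).
have m1 : val c1 - val c1 ^+ 2 / y (val e) \in recip_sums.
  exact: mem (fsvalP c1) (fsvalP c2) (fsvalP _) h2 h3.
exists [` m1] => /=; apply/eqP; have := nz c2.
by move: h3; rewrite /y => h3 c20; field; rewrite h3.
Qed.

End Lines.

(** * The lower bound on the set of sums *)

Lemma leq_double_pred n : (1 < n)%N -> (n <= 2 * (n - 1))%N.
Proof. lia. Qed.

Section Main.
Variables (F : fieldType) (p : nat) (A : {fset F}).
Hypotheses (pF : p \in [pchar F]) (p_odd : odd p) (A0 : 0 \notin A).

Local Notation S := (sumset (recip A) (recip (sumset A A))).

(** Since p is odd, a + a != 0, and translating 1/A by the fixed element 1/(a + a) stays in S. *)
Lemma card_le_recip_sums : (#|` A| <= #|` S|)%N.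
Proof.
have [->|[a aA]] := fset_0Vmem A; first by rewrite cardfs0.
have aa0 : a + a != 0.
  rewrite -mulr2n -mulr_natr mulf_neq0 //; first by apply: contraNneq A0 => <-.
  rewrite -(dvdn_pcharf pF) dvdn_prime2 ?(pcharf_prime pF) //.
  by apply: contraTneq p_odd => ->.
have mem (c : A) : (val c)^-1 + (a + a)^-1 \in S.
  by apply/in_sumset_recip => //; exists a, a, (val c); split=> //; apply: fsvalP.
rewrite !cardfE; apply: (leq_card (fun c : A => [` mem c])) => c c' /(congr1 val) /=.
by move=> /addIr/invr_inj/val_inj.
Qed.

Lemma recip_sums_lower_bound b : b = 2%N -> (1 < #|` A|)%N ->
  (#|` A| ^ 13 < p ^ 8)%N -> (#|` A| ^ 9 < b ^ 33 * #|` S| ^ 8)%N.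
Proof.
move=> b2 A1 Ap; rewrite ltnNge; apply/negP => small.
pose L := lines A; pose Sg := recip_sums A.
pose m (l : L) := (val l).1; pose k (l : L) := (val l).2; pose sg (x : Sg) := val x.
have cS : #|{: Sg}| = #|` S| by rewrite -cardfE card_recip_sums.
pose E := (\sum_w #|[pred w' | incident m k sg w w']|)%N.
have NL : (#|` A| ^ 2 <= 4 * #|` L|)%N.
  apply: (@leq_trans (2 * (#|` A| * (#|` A| - 1)))).
    by rewrite expnS expn1 mulnCA leq_mul2l leq_double_pred ?orbT.
  by rewrite (_ : 4%N = (2 * 2)%N) // -mulnA leq_mul2l card_lines_ge.
have LE : ((#|` L| * (#|` A| - 3)) ^ 2 <= E * #|` S|)%N.
  rewrite cardfE -cS; apply: incidence_energy; first exact: val_inj.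
  by move=> l; apply: lines_rich.
apply: (numeric_contradiction b2 (ltnW A1) card_le_recip_sums NL (card_lines_le A) Ap LE small).
move=> D s Dp s_le box rich.
(* The change of coordinates takes place over F(t), with t transcendental. *)
pose K : fieldType := {fraction {poly F}}.
pose iota : {rmorphism F -> K} := (@tofrac {poly F}) \o polyC.
have pK : p \in [pchar K] by rewrite (fmorph_pchar iota).
have free : forall a0 a1 a2 a3 : F,
    iota a0 + iota a1 * tofrac 'X + iota a2 * tofrac 'X ^+ 2 + iota a3 * tofrac 'X ^+ 3 = 0 ->
    [/\ a0 = 0, a1 = 0, a2 = 0 & a3 = 0].
  by move=> a0 a1 a2 a3; apply: fraction_X_free.
have m0 l : m l != 0 by apply: lines_slope.
have mk l l' : m l = m l' -> k l = k l' -> l = l'.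
  rewrite /m /k => e1 e2; apply: val_inj; move: e1 e2.
  by case: (val l) (val l') => [? ?] [? ?] /= -> ->.
have := @grid_incidences F K iota (tofrac 'X) p pK free L Sg m k sg m0 mk val_inj
  (2 * #|` A|) _ _ D s Dp; rewrite -!cardfE card_recip_sums; apply => //.
- by rewrite muln_gt0 (ltnW A1).
- by move=> x y z xyz; apply: few_lines_of.
Qed.

End Main.

Lemma powR_div_expn (R : realType) (a : R) k n : 0 <= a -> (0 < n)%N ->
  (a `^ (k%:R / n%:R)) ^+ n = a ^+ k.
Proof.
move=> a0 n0; rewrite -powR_mulrn ?powR_ge0 // -powRrM divfK ?powR_mulrn //.
by rewrite pnatr_eq0 -lt0n.
Qed.

Theorem proposition16 (R : realType) :
  exists c : R, 0 < c /\
    forall (F : fieldType) (p : nat) (A : {fset F}),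
      p \in [pchar F] -> odd p ->
      0 \notin A -> (1 < #|` A|)%N ->
      (#|` A|)%:R < (p%:R : R) `^ (8%:R / 13%:R) ->
      c * (#|` A|)%:R `^ (9%:R / 8%:R)
        <= (#|` sumset (recip A) (recip (sumset A A))|)%:R.
Proof.
have [b b2] : exists b, b = 2%N by exists 2%N.
have b0 : 0 < b%:R :> R by rewrite b2.
(* The constant is 2^(-33/8), the eighth root of the factor in [recip_sums_lower_bound]. *)
exists ((b%:R ^- 33) `^ (1%:R / 8%:R)); split; first by rewrite powR_gt0 // invr_gt0 exprn_gt0.
move=> F p A pF p_odd A0 A1 Ap.
have Ap' : (#|` A| ^ 13 < p ^ 8)%N.
  rewrite -(ltr_nat R) !natrX -(powR_div_expn 8 (ler0n R p) (isT : 0 < 13)%N).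
  by rewrite ltr_pXn2r // nnegrE ?powR_ge0.
have := recip_sums_lower_bound pF p_odd A0 b2 A1 Ap'.
rewrite -(ltr_nat R) natrM !natrX => lb.
rewrite -(@ler_pXn2r R 8) // ?nnegrE ?mulr_ge0 ?powR_ge0 //.
rewrite exprMn !powR_div_expn ?invr_ge0 ?exprn_ge0 ?(ltW b0) // expr1.
by rewrite mulrC ler_pdivrMr ?exprn_gt0 // mulrC ltW.
Qed.
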